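(* Let $K$ be a field of characteristic $0$ and let $n\ge4$ be an integer. Let $F_\bullet$ be a minimal free resolution of a set $X\subset\mathbb{P}^{n-2}$ of $n$ points in general position, with associated quadratic forms $\Omega_1,\ldots,\Omega_{n-1}$ and symbols $\{a_1\ldots a_n\}$. Put $$c_{ij}^k=\frac{1}{2n}\frac{\partial^2\Omega_k}{\partial x_i\,\partial x_j}\qquad(1\le i,j,k\le n-1).$$ Then for all distinct $i,j,k\in\{1,\ldots,n-1\}$, for suitable signs $\pm$ depending only on $n,i,j,k$ (possibly different in each of the four equations), \begin{align*} c^k_{ij}&=\pm\{i,i,1,\ldots,\widehat{ijk},\ldots,n-1,j,j\},\\ c^j_{ii}&=\pm\{i,i,1,\ldots,\widehat{ij},\ldots,n-1,i\},\\ c^j_{ij}-c^k_{ik}&=\pm\{i,i,1,\ldots,\widehat{ijk},\ldots,n-1,j,k\},\\ c^i_{ii}-c^j_{ij}-c^k_{ik}&=\pm\{i,j,1,\ldots,\widehat{ijk},\ldots,n-1,k,i\}. \end{align*} Moreover, when $n=4$, with $\pm$ the sign of the permutation taking $1,2,3$ to $i,j,k$, $$c^k_{ij}=\pm\{jjii\},\quad c^j_{ii}=\pm\{iiik\},\quad c^j_{ij}-c^k_{ik}=\pm\{iijk\},\quad c^i_{ii}-c^j_{ij}-c^k_{ik}=\pm\{ikij\};$$ and when $n=5$, with $\ell$ the remaining element of $\{1,2,3,4\}$ and $\pm$ the sign of the permutation taking $1,2,3,4$ to $i,j,k,\ell$, $$c^k_{ij}=\pm\{ii\ell jj\},\quad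 c^j_{ii}=\pm\{\ell iiik\},\quad c^j_{ij}-c^k_{ik}=\pm\{jk\ell ii\},\quad c^i_{ii}-c^j_{ij}-c^k_{ik}=\pm\{ij\ell ki\}.$$
   Context: Let $R=K[x_1,\ldots,x_{n-1}]$ with its usual grading and $\mathfrak{m}=(x_1,\ldots,x_{n-1})$. A set of $n$ points in general position is a zero-dimensional variety $X\subset\mathbb{P}^{n-2}$ defined over $K$, of degree $n$, such that $X(\bar K)$ consists of $n$ points no $n-1$ of which are contained in a hyperplane. Let $I\subset R$ be the homogeneous ideal of $X$. A minimal free resolution of $X$ means a minimal graded free resolution $F_\bullet$ of $R/I$, with graded differentials $\phi_k:F_k\to F_{k-1}$ satisfying $\phi_k(F_k)\subset\mathfrak{m}F_{k-1}$. It is known that for $n\ge4$ it has the form $$0\to R(-n)\xrightarrow{\phi_{n-2}}R(-n+2)^{b_{n-3}}\xrightarrow{\phi_{n-3}}\cdots\to R(-3)^{b_2}\xrightarrow{\phi_2}R(-2)^{b_1}\xrightarrow{\phi_1}R\to0,$$ with $b_i=n\binom{n-2}{i}-\binom{n}{i+1}$ (for $n=4$: $0\to R(-4)\xrightarrow{\phi_2}R(-2)^2\xrightarrow{\phi_1}R\to 0$). Choosing bases, $\phi_k$ also denotes the matrix representing it; $\phi_1$ (a row vector) and $\phi_{n-2}$ (a column vector) have quadratic form entries, and the other $\phi_k$ have linear form entries. Quadratic forms: $[a_1,\ldots,a_{n-2}]=\frac{\partial\phi_1}{\partial x_{a_1}}\cdots\frac{\partial\phi_{n-2}}{\partial x_{a_{n-2}}}$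 (entrywise derivatives, matrix product); $[[a_1,\ldots,a_{n-2}]]=\sum_{k=1}^{n-2}[a_{\sigma^{2k}(1)},\ldots,a_{\sigma^{2k}(n-2)}]$ where $\sigma=(1\,2\ldots n-2)\in S_{n-2}$ is the $(n-2)$-cycle; $\Omega_j=(-1)^j[[1,\ldots,\widehat j,\ldots,n-1]]$ for $1\le j\le n-1$. Symbols: write $\phi_1=\sum_{i\le j}P(i,j)x_ix_j$ and $\phi_{n-2}=\sum_{i\le j}Q(i,j)x_ix_j$ with $P(i,j)$ row vectors and $Q(i,j)$ column vectors over $K$, and set $P(j,i)=P(i,j)$, $Q(j,i)=Q(i,j)$. For $1\le a_1,\ldots,a_n\le n-1$ put $$\{a_1a_2\ldots a_n\}=P(a_1,a_2)\frac{\partial\phi_2}{\partial x_{a_3}}\cdots\frac{\partial\phi_{n-3}}{\partial x_{a_{n-2}}}Q(a_{n-1},a_n)\in K$$ (for $n=4$ this is $P(a_1,a_2)Q(a_3,a_4)$); commas between entries are optional. The notation $1,\ldots,\widehat{ijk},\ldots,n-1$ means the increasing sequence $1,\ldots,n-1$ with $i,j,k$ deleted (in whatever order they occur), and similarly for $\widehat{ij}$. *)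

(* Defs.v *)
From HB Require Import structures.
From mathcomp Require Import all_boot all_order all_algebra all_fingroup.
From mathcomp Require Import mpoly.

Set Implicit Arguments.
Unset Strict Implicit.
Unset Printing Implicit Defensive.

Import GRing.Theory.
Local Open Scope ring_scope.

Section Points.

Variables (K : fieldType) (L : closedFieldType) (iota : {rmorphism K -> L}).

Definition is_algebraic_closure : Prop := forall x : L, algebraicOver iota x.

(* Points of P^(N-1)(L) are given by homogeneous coordinates. *)
Definition same_point (N : nat) (u v : 'rV[L]_N) : Prop :=
  exists2 c : L, c != 0 & u = c *: v.

Definition vanishes_at (N : nat) (f : {mpoly K[N]}) (v : 'rV[L]_N) : Prop :=
  (map_mpoly iota f).@[v 0] = 0.

(* The set of points X is the zero locus of some set of homogeneous
   polynomials with coefficients in K. *)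
Definition defined_over_base (N n : nat) (X : 'I_n -> 'rV[L]_N) : Prop :=
  exists2 S : {mpoly K[N]} -> Prop,
    (forall f, S f -> exists d, f \is d.-homog) &
    (forall v : 'rV[L]_N, v != 0 ->
      (forall f, S f -> vanishes_at f v) <-> (exists a, same_point v (X a))).

Record points_in_general_position (n : nat) (X : 'I_n -> 'rV[L]_n.-1) : Prop :=
  PointsInGeneralPosition {
    points_nonzero : forall a, X a != 0;
    points_distinct : forall a b, same_point (X a) (X b) -> a = b;
    points_defined : defined_over_base X;
    points_general : forall A : {set 'I_n}, #|A| = n.-1 ->
      ~ (exists2 h : 'cV[L]_n.-1, h != 0 &
           forall a, a \in A -> X a *m h = 0) }.

(* The homogeneous ideal of X: all homogeneous components vanish on X. *)
Definition points_ideal (N n : nat) (X : 'I_n -> 'rV[L]_N) (f : {mpoly K[N]}) :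
    Prop :=
  forall d a, vanishes_at (pihomog mdeg d f) (X a).

End Points.

(* The resolution is F_k = R(- shift n k)^(betti n k), with R = K[x_1..x_(n-1)].
   For k > n - 2 the truncated difference is 0, so that F_k = 0. *)
Definition betti (n k : nat) : nat :=
  if (k == 0%N) || (k == n.-2) then 1%N
  else (n * 'C(n.-2, k) - 'C(n, k.+1))%N.

Definition shift (n k : nat) : nat :=
  if k == 0%N then 0%N else if k == n.-2 then n else k.+1.

(* [phi k] is the matrix of the differential F_(k+1) -> F_k, acting on column
   vectors: it is what is usually written phi_(k+1). *)
Definition differentials (K : fieldType) (n : nat) : Type :=
  forall k : nat, 'M[{mpoly K[n.-1]}]_(betti n k, betti n k.+1).

Record minimal_free_resolution (K : fieldType) (n : nat)
    (I : {mpoly K[n.-1]} -> Prop) (phi : differentials K n) : Prop :=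
  MinimalFreeResolution {
    mfr_graded : forall k i j,
      phi k i j \is (shift n k.+1 - shift n k)%N.-homog;
    (* phi maps F_(k+1) into m F_k *)
    mfr_minimal : forall k i j, (phi k i j)@_0%MM = 0;
    mfr_augmentation : forall f : {mpoly K[n.-1]},
      I f <-> exists w : 'cV[{mpoly K[n.-1]}]_(betti n 1),
                phi 0%N *m w = const_mx f;
    mfr_exact : forall k (v : 'cV[{mpoly K[n.-1]}]_(betti n k.+1)),
      phi k *m v = 0 <->
      exists w : 'cV[{mpoly K[n.-1]}]_(betti n k.+2), v = phi k.+1 *m w }.

Lemma betti_first (n : nat) : betti n 0 = 1%N.
Proof. by []. Qed.

Lemma betti_last (n : nat) : betti n n.-2 = 1%N.
Proof. by rewrite /betti eqxx orbT. Qed.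

(* The product A 0 *m ... *m A m.-1. *)
Fixpoint chain_mul (S : nzRingType) (r : nat -> nat)
    (A : forall k, 'M[S]_(r k, r k.+1)) (m : nat) : 'M[S]_(r 0%N, r m) :=
  if m is m'.+1 then chain_mul A m' *m A m' else 1%:M.

(* The product A 0 *m ... *m A (n - 3), a 1 x 1 matrix, as a scalar. *)
Definition full_product (S : nzRingType) (n : nat)
    (A : forall k, 'M[S]_(betti n k, betti n k.+1)) : S :=
  castmx (betti_first n, betti_last n) (chain_mul A n.-2) 0 0.

Section Forms.

Variables (K : fieldType) (n : nat) (phi : differentials K n).

(* The variables x_1, ..., x_(n-1) are 'X_i with i : 'I_n.-1, so that x_(i+1)
   is 'X_i. Index sequences are of type seq 'I_n.-1; the head of the sequence
   is only used as the default value of nth. *)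

Definition dphi (k : nat) (a : 'I_n.-1) :
    'M[{mpoly K[n.-1]}]_(betti n k, betti n k.+1) :=
  map_mx (mderiv a) (phi k).

(* [a_1, ..., a_(n-2)] *)
Definition bracket (s : seq 'I_n.-1) : {mpoly K[n.-1]} :=
  if s is x :: _ then full_product (fun k => dphi k (nth x s k)) else 0.

(* [[a_1, ..., a_(n-2)]]; rot 1 turns a_1, ..., a_(n-2) into
   a_(sigma 1), ..., a_(sigma (n-2)) for sigma = (1 2 ... n-2). *)
Definition dbracket (s : seq 'I_n.-1) : {mpoly K[n.-1]} :=
  \sum_(1 <= k < n.-1) bracket (iter (2 * k) (rot 1) s).

(* The increasing sequence of all indices, with those in s deleted. *)
Definition omit (s : seq 'I_n.-1) : seq 'I_n.-1 :=
  [seq a <- enum 'I_n.-1 | a \notin s].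

(* The index j stands for j + 1, whence the exponent. *)
Definition Omega (j : 'I_n.-1) : {mpoly K[n.-1]} :=
  (-1) ^+ j.+1 * dbracket (omit [:: j]).

(* Coefficient of x_a x_b: P(a,b) for k = 0 and Q(a,b) for k = n - 3. *)
Definition quad_coef (k : nat) (a b : 'I_n.-1) :
    'M[K]_(betti n k, betti n k.+1) :=
  map_mx (mcoeff (U_(a) + U_(b))%MM) (phi k).

(* The derivative of a matrix of linear forms, as a matrix of constants. *)
Definition dphi_const (k : nat) (a : 'I_n.-1) :
    'M[K]_(betti n k, betti n k.+1) :=
  map_mx (mcoeff 0%MM) (dphi k a).

(* {a_1 a_2 ... a_n} *)
Definition symb (s : seq 'I_n.-1) : K :=
  if s is x :: _ then
    full_product (fun k =>
      if k == 0%N then quad_coef k (nth x s 0) (nth x s 1)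
      else if k == (n - 3)%N then quad_coef k (nth x s (n - 2)) (nth x s (n - 1))
      else dphi_const k (nth x s k.+1))
  else 0.

(* c^k_(ij), as a constant polynomial *)
Definition coef_c (k i j : 'I_n.-1) : {mpoly K[n.-1]} :=
  ((2 * n)%:R^-1 : K) *: (Omega k)^`M(j)^`M(i).

End Forms.

(* Main.v *)
(** Up to the factors 1 + [a = b] and 1 + [c = e], the symbol {a b w c e} is
    T(a,b|w|c,e), in which the end factors P and Q are replaced by second
    derivatives of phi_1 and phi_(n-2). Differentiating phi_k phi_(k+1) = 0
    shows that T is alternating in w and that its cyclic sums over a, b, w_1
    and over w_last, c, e vanish. The resolution carries a multiplication that
    satisfies the Leibniz rule; its constant terms pair F_i with F_(n-2-i),
    and moving the phi_k across this pairing gives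
    T(c,e|w|a,b) = - T(a,b|w|c,e).

    The Hessian of a bracket [x, w, y] in the directions i, j is
    T(x,i|w|j,y) + T(x,j|w|i,y). Normalised by the sign of the arrangement, it
    is of the form A + F(x) + F(y). Since sigma^2k is even and every index is
    an end point twice in the sum over k, this evaluates [[...]] to a closed
    form C(i,j;x,w,y), which can be written with any arrangement of the
    indices. The relations for T then give
    2n T(a,b|w|c,e) = C(a,c;b,w,e) + C(a,e;b,w,c) + C(b,c;a,w,e) + C(b,e;a,w,c),
    of which all the equations of the theorem are special cases. *)

Require Import Defs.
From HB Require Import structures.
From mathcomp Require Import all_boot all_order all_algebra all_fingroup.
From mathcomp Require Import mpoly ring.
From Stdlib Require Import ClassicalEpsilon.

Set Implicit Arguments.
Unset Strict Implicit.
Unset Printing Implicit Defensive.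

Import GRing.Theory.
Local Open Scope ring_scope.

(** * Alternating functions and signs *)

Section Alternating.

Variables (I : eqType) (K : comNzRingType) (n : nat) (f : seq I -> K).

(** The law is demanded at length [n] only: a symbol reads a fixed number of entries of its interior
    word, and exchanging entries beyond them would not change its value. *)
Definition alternating : Prop :=
  forall s1 x y s2, size (s1 ++ x :: y :: s2) = n ->
    f (s1 ++ y :: x :: s2) = - f (s1 ++ x :: y :: s2).

Hypothesis f_alt : alternating.

Lemma alternating_move s1 x w s2 : size (s1 ++ x :: w ++ s2) = n ->
  f (s1 ++ x :: w ++ s2) = (-1) ^+ size w * f (s1 ++ w ++ x :: s2).
Proof.
elim: w s1 => [|y w IH] s1 /=; first by rewrite expr0 mul1r.
move=> sz; rewrite -[s1 ++ x :: _]/(s1 ++ x :: y :: (w ++ s2)).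
rewrite f_alt; last by rewrite -sz !size_cat.
rewrite -cat_rcons IH; last by rewrite -sz !size_cat size_rcons /= !size_cat
  !addSnnS.
by rewrite cat_rcons exprS mulN1r mulNr.
Qed.

(** The exchange takes [2 * size w + 1] adjacent swaps, an odd number for every [w]. *)
Lemma alternating_exchange s1 x w y s2 :
  size (s1 ++ x :: w ++ y :: s2) = n ->
  f (s1 ++ y :: w ++ x :: s2) = - f (s1 ++ x :: w ++ y :: s2).
Proof.
move=> sz; rewrite alternating_move; last by rewrite -sz !size_cat /= !size_cat.
rewrite catA f_alt -?catA; last by rewrite -sz !size_cat /= !size_cat /= !addnS.
by rewrite mulrN [in RHS]alternating_move.
Qed.

(** The exponent is the number of inversions in the reversal of [size w] entries. *)
Lemma alternating_rev w s2 : size (w ++ s2) = n ->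
  f (rev w ++ s2) = (-1) ^+ (\sum_(r < size w) r)%N * f (w ++ s2).
Proof.
elim: w s2 => [|x w IH] s2 /= sz; first by rewrite big_ord0 mul1r.
rewrite rev_cons cat_rcons IH; last by rewrite -sz !size_cat /= addnS.
rewrite big_ord_recr exprD /= -mulrA; congr (_ * _).
by rewrite -[x :: w ++ s2]/([::] ++ x :: w ++ s2) alternating_move //= signrMK.
Qed.

Lemma alternating_cons x s1 s2 : size (x :: s1 ++ s2) = n ->
  f (x :: s1 ++ s2) = (-1) ^+ size s1 * f (s1 ++ x :: s2).
Proof. exact: (@alternating_move [::]). Qed.

End Alternating.

(** Adjacent swaps generate all permutations: the head [x] of [s] is brought to the front of [t],
    and the induction continues with the function that prepends [x]. Invariance is assumed instead
    of a sign, so that products of two alternating functions are covered. *)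
Lemma perm_eq_swap_ind (I : eqType) (A : Type) (f : seq I -> A) (s t : seq I) :
  (forall s1 x y s2, size (s1 ++ x :: y :: s2) = size s ->
     f (s1 ++ y :: x :: s2) = f (s1 ++ x :: y :: s2)) ->
  perm_eq s t -> f s = f t.
Proof.
elim: s f t => [|x s IH] f t f_swap; first by rewrite perm_sym => /perm_nilP->.
move=> st; have := perm_mem st x; rewrite mem_head => /esym/path.splitPr t_def.
case: t_def st => t1 t2 st.
have {}st : perm_eq s (t1 ++ t2).
  by rewrite -(perm_cons x) (perm_trans st) // -cat1s perm_catCA.
have sz := perm_size st.
rewrite (IH (fun u => f (x :: u)) (t1 ++ t2)) //; last first.
  by move=> s1 y z s2 sz'; apply: (f_swap (x :: s1)); rewrite /= sz'.
have {}sz : size (x :: t1 ++ t2) = size (x :: s) by rewrite /= sz.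
suff move_x u : size (u ++ x :: t1 ++ t2) = size (x :: s) ->
    f (u ++ x :: t1 ++ t2) = f (u ++ t1 ++ x :: t2) by exact: (move_x [::]).
elim: t1 u {st sz} => [//|y t1 IHt] u sz.
rewrite -[LHS]/(f (u ++ x :: y :: (t1 ++ t2))) -f_swap;
  last by rewrite -sz !size_cat.
rewrite -cat_rcons IHt ?cat_rcons //.
by rewrite -sz !size_cat.
Qed.

(** * The sign of a sequence read as a permutation *)

Section Signature.

Variables (d : nat) (K : comNzRingType).

(* 0 if [s] is not the list of values of a permutation *)
Definition signature (s : seq 'I_d) : K :=
  \sum_(sigma : 'S_d | codom sigma == s) (-1) ^+ sigma.

Lemma nth_codom_ord (x i : 'I_d) (sigma : 'S_d) : nth x (codom sigma) i = sigma i.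
Proof. by rewrite (nth_map x) ?size_enum_ord // nth_ord_enum. Qed.

Lemma codom_perm_inj : injective (fun sigma : 'S_d => codom sigma).
Proof.
move=> sigma tau /= e; apply/permP=> i.
by rewrite -(nth_codom_ord i i sigma) -(nth_codom_ord i i tau) e.
Qed.

Lemma signature_codom (sigma : 'S_d) : signature (codom sigma) = (-1) ^+ sigma.
Proof.
rewrite /signature (big_pred1 sigma) // => tau.
by rewrite (inj_eq codom_perm_inj).
Qed.

Lemma exists_codom (s : seq 'I_d) : uniq s -> size s = d ->
  exists sigma : 'S_d, codom sigma = s.
Proof.
case: s => [|x s] s_uniq sz.
  by exists 1%g; apply: size0nil; rewrite size_codom card_ord -sz.
have inj : injective (fun i : 'I_d => nth x (x :: s) i).
  move=> i j /eqP; rewrite nth_uniq ?sz // => /eqP; exact: val_inj.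
exists (perm inj); apply: (@eq_from_nth _ x);
  first by rewrite size_codom card_ord sz.
move=> i; rewrite size_codom card_ord => lt_i.
by rewrite -[i]/(nat_of_ord (Ordinal lt_i)) nth_codom_ord permE.
Qed.

Lemma signature_nuniq (s : seq 'I_d) : ~~ uniq s -> signature s = 0.
Proof.
move=> s_nuniq; apply: big_pred0 => sigma; apply: contraNF s_nuniq => /eqP<-.
by rewrite map_inj_uniq ?enum_uniq //; apply: perm_inj.
Qed.

(** Swapping the entries at positions [p] and [p.+1] amounts to composing with the transposition
    [tperm a b], so the two sums correspond by reindexing. Sequences with repetitions are covered
    too, both sums being empty. *)
Lemma signature_alt : alternating d signature.
Proof.
move=> s1 x y s2 sz; set p := size s1; have szE := sz; rewrite size_cat /= in szE.
have lt_p : (p < d)%N by rewrite -szE -addSnnS leq_addr.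
have lt_p1 : (p.+1 < d)%N by rewrite -szE -2!addSnnS leq_addr.
pose a := Ordinal lt_p; pose b := Ordinal lt_p1.
have ab : a != b by rewrite -val_eqE /= neq_ltn ltnSn.
have swap u v (sigma : 'S_d) : codom sigma = s1 ++ u :: v :: s2 ->
    codom (tperm a b * sigma)%g = s1 ++ v :: u :: s2.
  move=> e; apply: (@eq_from_nth _ x).
    by rewrite size_codom card_ord size_cat.
  rewrite size_codom card_ord => i lt_i.
  rewrite -[i]/(nat_of_ord (Ordinal lt_i)) nth_codom_ord permM.
  move: (Ordinal lt_i) => {lt_i}i; rewrite -(nth_codom_ord x) e.
  case: tpermP => [->|->|/eqP ia /eqP ib]; rewrite !nth_cat /=.
  - by rewrite -/p ltnn ltnNge leqnSn subSnn subnn.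
  - by rewrite -/p ltnn ltnNge leqnSn subSnn subnn.
  case: ltnP => // le_pi; move: ia ib; rewrite -!val_eqE /=.
  by rewrite -/p -(subnKC le_pi) -/p addKn; case: (i - p)%N => [|[|k]];
    rewrite ?addn0 ?addn1 ?eqxx.
rewrite /signature (reindex_inj (mulgI (tperm a b))) /= -sumrN.
apply: eq_big => [sigma|sigma _]; last by rewrite odd_permM odd_tperm ab signrN.
apply/eqP/eqP; last exact: swap.
by move=> /swap; rewrite mulgA tperm2 mul1g.
Qed.

End Signature.
(** * Relations between symbols *)

Definition subst_nth (A : Type) (w : seq A) (r : nat) (y : A) : seq A :=
  take r w ++ y :: drop r.+1 w.

Lemma size_subst_nth (A : Type) (w : seq A) r y :
  (r < size w)%N -> size (subst_nth w r y) = size w.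
Proof.
by move=> lt_r; rewrite size_cat size_take lt_r /= size_drop -addSnnS subnKC.
Qed.

Lemma size_cons_delete (A : Type) (w : seq A) r y :
  (r < size w)%N -> size (y :: take r w ++ drop r.+1 w) = size w.
Proof. by move/(size_subst_nth y) => <-; rewrite /= !size_cat addnS. Qed.

Lemma subst_nth_id (A : Type) (w : seq A) r x :
  (r < size w)%N -> subst_nth w r (nth x w r) = w.
Proof. by move=> lt_r; rewrite /subst_nth -drop_nth // cat_take_drop. Qed.

(** As [l] runs from 1 to [N], the indices [l.*2.-1] and [l.*2] together run through 1, ..., [N.*2],
    that is, through two full periods. *)
Lemma sum_double_period (V : nmodType) (g : nat -> V) N :
  (forall p, g (p + N)%N = g p) ->
  \sum_(1 <= l < N.+1) (g l.*2 + g l.*2.-1) = (\sum_(p < N) g p) *+ 2.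
Proof.
move=> g_per; have -> : (\sum_(p < N) g p) *+ 2 = \sum_(0 <= p < N.*2) g p.
  rewrite -addnn (big_cat_nat (n := N)) ?leq_addr //= mulr2n.
  rewrite big_mkord; congr (_ + _).
  rewrite -[RHS]/(\sum_(0 + N <= p < N + N) g p) big_addn addnK big_mkord.
  by apply: eq_bigr => p _; rewrite g_per.
transitivity (\sum_(1 <= p < N.*2.+1) g p).
  elim: (N) => [|q IH]; first by rewrite !big_geq.
  rewrite big_nat_recr // IH doubleS /=.
  by rewrite [RHS]big_nat_recr //= [X in _ = X + _]big_nat_recr //= -addrA [X in _
    + X]addrC.
case: N g_per => [|N] g_per; first by rewrite !big_geq.
rewrite big_nat_recr // [RHS]big_ltn // [RHS]addrC; congr (_ + _).
by rewrite -addnn g_per -[N.+1]add0n g_per.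
Qed.

Section SymbolAlgebra.

Variables (K : comNzRingType) (m : nat).
Local Notation I := 'I_m.+3.
Implicit Types (a b c e i j k x y z : I) (w u : seq I).

(** Here [n = m + 4], and the interior word [w] has length [m]; for [m = 0] the alternation and both
    cyclic relations are vacuous. *)
Record symbol_relations (T : I -> I -> seq I -> I -> I -> K) : Prop :=
  SymbolRelations {
    symbol_symL : forall a b w c e, T a b w c e = T b a w c e;
    symbol_symR : forall a b w c e, T a b w c e = T a b w e c;
    symbol_alt : forall a b c e, alternating m (fun w => T a b w c e);
    symbol_cycL : forall a b x w c e, size (x :: w) = m ->
      T a b (x :: w) c e + T b x (a :: w) c e + T x a (b :: w) c e = 0;
    symbol_cycR : forall a b x w c e, size (x :: w) = m ->
      T a b (x :: w) c e + T a b (c :: w) e x + T a b (e :: w) x c = 0;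
    symbol_rev : forall a b w c e, size w = m -> T c e w a b = - T a b w c e }.

Variables (T : I -> I -> seq I -> I -> I -> K) (TP : symbol_relations T).

Let symL := symbol_symL TP.
Let symR := symbol_symR TP.
Let alt := symbol_alt TP.
Let cycL := symbol_cycL TP.
Let cycR := symbol_cycR TP.
Let revT := symbol_rev TP.

Lemma symbol_to_head a b w r y c e : size w = m -> (r < m)%N ->
  T a b (subst_nth w r y) c e = (-1) ^+ r * T a b (y :: take r w ++ drop r.+1 w) c e.
Proof.
move=> sz lt_r; have ht : size (take r w) = r by rewrite size_take sz lt_r.
rewrite (alternating_cons (alt a b c e)) ?size_cons_delete ?sz //.
by rewrite ht signrMK.
Qed.

Lemma symbol_cycL_at a b x w r c e : size w = m -> (r < m)%N ->
  T a b (subst_nth w r x) c e + T b x (subst_nth w r a) c e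
    + T x a (subst_nth w r b) c e = 0.
Proof.
move=> sz lt_r; rewrite !symbol_to_head // -!mulrDr cycL ?mulr0 //.
by rewrite size_cons_delete sz.
Qed.

Lemma symbol_cycR_at a b x w r c e : size w = m -> (r < m)%N ->
  T a b (subst_nth w r x) c e + T a b (subst_nth w r c) e x
    + T a b (subst_nth w r e) x c = 0.
Proof.
move=> sz lt_r; rewrite !symbol_to_head // -!mulrDr cycR ?mulr0 //.
by rewrite size_cons_delete sz.
Qed.

(* The second derivative in the directions i and j of the quadratic form
   [x, w, y]. *)
Definition bracket_hess i j x w y : K := T x i w j y + T x j w i y.

(* The sum of [bracket_hess] over the rotations sigma^2k of (x, w, y), in
   closed form (see [sum_rot_bracket_hess]). *)
Definition dbracket_hess i j x w y : K :=
  m.+2%:R * bracket_hess i j x w y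
  + \sum_(r < m) (T y (nth ord0 w r) (subst_nth w r x) i j
                  - T x (nth ord0 w r) (subst_nth w r y) i j).

Lemma bracket_hessC i j x w y : bracket_hess i j x w y = bracket_hess j i x w y.
Proof. exact: addrC. Qed.

Lemma bracket_hess_rev i j x w y : size w = m ->
  bracket_hess i j y w x = - bracket_hess i j x w y.
Proof.
move=> sz; rewrite /bracket_hess opprD.
rewrite (@revT j x w y i) // (@revT i x w y j) // addrC.
by rewrite (symL j x) (symL i x) (symR x j w y i) (symR x i w y j).
Qed.

Lemma dbracket_hessC i j x w y : dbracket_hess i j x w y = dbracket_hess j i x w y.
Proof.
rewrite /dbracket_hess bracket_hessC; congr (_ + _); apply: eq_bigr => r _.
by rewrite symR [X in _ - X]symR.
Qed.

Lemma dbracket_hess_diag i j x w : size w = m -> 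
  m.+2%:R * bracket_hess i j x w x = 0 -> dbracket_hess i j x w x = 0.
Proof.
by move=> sz h; rewrite /dbracket_hess h add0r big1 // => r _; rewrite subrr.
Qed.

Lemma symbolE a b w c e : size w = m ->
  dbracket_hess a c b w e + dbracket_hess a e b w c
    + dbracket_hess b c a w e + dbracket_hess b e a w c
  = (2 * m.+4)%:R * T a b w c e.
Proof.
move=> sz; rewrite /dbracket_hess.
have -> (p q r s p' q' r' s' : K) :
  p + p' + (q + q') + (r + r') + (s + s')
    = (p + q + r + s) + (p' + q' + r' + s') by ring.
rewrite -!mulrDr -!big_split /=.
(* Of the eight symbols, four equal [T a b w c e] by symmetry; the other four cancel in pairs by
   reversal. *)
have -> : bracket_hess a c b w e + bracket_hess a e b w c
    + bracket_hess b c a w e + bracket_hess b e a w c = 4%:R * T a b w c e.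
  rewrite /bracket_hess !(symL b a) (symR a b w e c).
  by rewrite (@revT a e w b c) // (@revT a c w b e) //; ring.
(* Each position [r] contributes -2 T, which makes the total coefficient 4 (m + 2) - 2 m = 2 (m +
   4). *)
rewrite (eq_bigr (fun=> - (2%:R * T a b w c e))) => [|r _].
  by rewrite sumr_const card_ord -mulr_natl; ring.
have lt_r : (r < m)%N by []; pose z := nth ord0 w r.
have wE : subst_nth w r z = w by rewrite subst_nth_id ?sz.
(* [R1] to [R4] reduce the eight terms to four, two with [c, e] as right end pair and two with
   [a, b]. [L1] turns the former into -T, and [L2], after a reversal, the latter into -T as well. *)
have R1 := symbol_cycR_at b z e a c sz lt_r.
have R2 := symbol_cycR_at a z e b c sz lt_r.
have R3 := symbol_cycR_at e z b a c sz lt_r.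
have R4 := symbol_cycR_at c z b a e sz lt_r.
have L1 := symbol_cycL_at a b z c e sz lt_r.
have L2 := symbol_cycL_at c e z a b sz lt_r.
rewrite wE in L1 L2; rewrite -/z.
rewrite (@revT a b w c e) // in L2.
rewrite (symL z a) in L1; rewrite (symL z c) in L2.
move: R1 R2 R3 R4 L1 L2; rewrite (symR b z _ e a) (symR a z _ e b).
rewrite (symR e z _ b a) (symR c z _ b a) .
rewrite (symR e z _ c b) (symR c z _ e b) => R1 R2 R3 R4 L1 L2.
have comb (r1 r2 r3 r4 l1 l2 : K) : r1 = 0 -> r2 = 0 -> r3 = 0 -> r4 = 0 ->
    l1 = 0 -> l2 = 0 -> r3 + r4 - r1 - r2 + l1 - l2 = 0.
  by do 6!move=> ->; ring.
apply/eqP; rewrite -subr_eq0 -(comb _ _ _ _ _ _ R1 R2 R3 R4 L1 L2).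
by apply/eqP; ring.
Qed.

(** * Summation of the bracket Hessians over the rotations sigma^2k *)

Section Rotations.

Variables (k i j : I).

Let sg := @signature m.+3 K.
Local Notation rest s := [seq a <- enum 'I_m.+3 | a \notin s].

(* [bracket_hess] of any arrangement of the indices other than k that has the
   end points x and y, normalised by its sign. *)
Definition hess_at x y : K :=
  sg (k :: x :: rcons (rest [:: k; x; y]) y)
  * bracket_hess i j x (rest [:: k; x; y]) y.

(** The change of [hess_at] when the end point [z] is replaced by [x], whatever the other end point
    is; see [hess_at_diff]. *)
Definition hess_diff x z : K :=
  - (sg (k :: x :: rcons (rest [:: k; x; z]) z) * T x z (rest [:: k; x; z]) i j).

Lemma mem_full_uniq s a : uniq s -> size s = m.+3 -> a \in s.
Proof.
move=> s_uniq sz; have [||_ ->] := uniq_min_size s_uniq (s2 := enum 'I_m.+3).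
- by move=> b _; rewrite mem_enum.
- by rewrite size_enum_ord sz.
- by rewrite mem_enum.
Qed.

Lemma perm_rest s w : uniq (s ++ w) -> size (s ++ w) = m.+3 ->
  perm_eq w (rest s).
Proof.
move=> s_uniq sz; have full a := mem_full_uniq a s_uniq sz.
move: s_uniq; rewrite cat_uniq => /and3P[_ /hasPn h w_uniq].
apply: uniq_perm => //; first by rewrite filter_uniq ?enum_uniq.
move=> a; rewrite mem_filter mem_enum andbT; have := full a.
rewrite mem_cat; case: (boolP (a \in s)) => //= sa _.
by apply/negP=> /h; rewrite /= sa.
Qed.

Lemma uniq_cat_rest s : uniq s -> uniq (s ++ rest s).
Proof.
move=> s_uniq; rewrite cat_uniq s_uniq filter_uniq ?enum_uniq // andbT.
by apply/hasPn=> a; rewrite mem_filter => /andP[].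
Qed.

Lemma size_cat_rest s : uniq s -> size (s ++ rest s) = m.+3.
Proof.
move=> s_uniq; have : perm_eq (s ++ rest s) (enum 'I_m.+3).
  apply: uniq_perm; rewrite ?uniq_cat_rest ?enum_uniq // => a.
  by rewrite mem_cat mem_filter mem_enum andbT; case: (a \in s).
by move/perm_size; rewrite size_enum_ord.
Qed.

(** Both factors change sign under an adjacent swap in the middle block. The condition on [u] and
    [v] gives the whole sequence length [m.+3], at which the signature alternates. *)
Lemma signature_mul_perm (f : seq I -> K) u v w w' :
  (size u + size v = 3)%N -> alternating m f -> size w = m -> perm_eq w w' ->
  sg (u ++ w ++ v) * f w = sg (u ++ w' ++ v) * f w'.
Proof.
move=> sz_uv f_alt sz_w ww'.
apply: (perm_eq_swap_ind (f := fun w => sg (u ++ w ++ v) * f w)) ww'.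
move=> s1 x y s2; rewrite sz_w => sz; rewrite f_alt //.
have catE a b : u ++ (s1 ++ a :: b :: s2) ++ v = (u ++ s1) ++ a :: b :: (s2 ++ v).
  by rewrite -!catA.
rewrite !catE /sg signature_alt ?mulrNN // -catE !(size_cat u) size_cat sz.
by rewrite addnCA sz_uv addn3.
Qed.

Lemma uniq_swap23 x y w : uniq [:: k, x, y & w] -> uniq [:: k, y, x & w].
Proof. by rewrite (@perm_uniq _ _ [:: k, x, y & w]) // perm_cons (perm_catCA [:: y]
  [:: x]). Qed.

Lemma hess_atE x y w : uniq [:: k, x, y & w] -> size w = m ->
  sg (k :: x :: rcons w y) * bracket_hess i j x w y = hess_at x y.
Proof.
move=> s_uniq sz; rewrite /hess_at -!cats1.
apply: (@signature_mul_perm (fun w => bracket_hess i j x w y) [:: k;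
  x] [:: y]) => //.
  by move=> s1 a b s2 sz'; rewrite /bracket_hess (alt x i j y) // (alt x j i y) //
    opprD.
by apply: perm_rest => //=; rewrite sz.
Qed.

Lemma hess_diffE x z w : uniq [:: k, x, z & w] -> size w = m ->
  - (sg (k :: x :: rcons w z) * T x z w i j) = hess_diff x z.
Proof.
move=> s_uniq sz; rewrite /hess_diff -!cats1; congr (- _).
apply: (@signature_mul_perm (fun w => T x z w i j) [:: k; x] [:: z]) => //.
by apply: perm_rest => //=; rewrite sz.
Qed.

Lemma signature_swap_ends x w y : size w = m ->
  sg (k :: y :: rcons w x) = - sg (k :: x :: rcons w y).
Proof.
move=> sz; rewrite -!cats1 -[k :: y :: _]/([:: k] ++ y :: w ++ x :: [::]).
rewrite /sg (alternating_exchange (@signature_alt _ K)) //.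
by rewrite /= size_cat sz addn1.
Qed.

Lemma size_rest3 x y : uniq [:: k; x; y] -> size (rest [:: k; x; y]) = m.
Proof. by move=> s_uniq; apply: (@addnI 3); exact: (size_cat_rest s_uniq). Qed.

Lemma hess_atC x y : uniq [:: k; x; y] -> hess_at x y = hess_at y x.
Proof.
move=> s_uniq; have sz := size_rest3 s_uniq; have w_uniq := uniq_cat_rest s_uniq.
rewrite -(hess_atE (uniq_swap23 w_uniq) sz) /hess_at signature_swap_ends //.
by rewrite (@bracket_hess_rev _ _ x) // mulrNN.
Qed.

Lemma hess_diffxx x : hess_diff x x = 0.
Proof.
rewrite /hess_diff /sg signature_nuniq ?mul0r ?oppr0 //=.
by rewrite mem_rcons mem_head andbF.
Qed.

Lemma hess_diffC x z : uniq [:: k; x; z] -> hess_diff x z = - hess_diff z x.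
Proof.
move=> s_uniq; have sz := size_rest3 s_uniq; have w_uniq := uniq_cat_rest s_uniq.
rewrite -(hess_diffE (uniq_swap23 w_uniq) sz) /hess_diff.
by rewrite (signature_swap_ends x) // (symL z x) mulNr opprK.
Qed.

Lemma size_rest4 x y z : uniq [:: k; x; y; z] ->
  (size (rest [:: k; x; y; z])).+1 = m.
Proof. by move=> s_uniq; apply: (@addnI 3); exact: (size_cat_rest s_uniq). Qed.

Lemma uniq4 x y z (w := rest [:: k; x; y; z]) : uniq [:: k; x; y; z] ->
  [/\ uniq [:: k, x, y, z & w], uniq [:: k, x, z, y & w],
      uniq [:: k, y, x, z & w] & uniq [:: k, z, y, x & w]].
Proof.
move=> s_uniq; have w_uniq := uniq_cat_rest s_uniq.
by split; rewrite (@perm_uniq _ _ ([:: k; x; y; z] ++ w)) //= perm_cons;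
  apply/seq.permP => p /=; ring.
Qed.

(** Once the three terms carry a common sign, this is the left cyclic relation. *)
Lemma hess_diff_add x y z : uniq [:: k; x; y; z] ->
  hess_diff x z + hess_diff z y + hess_diff y x = 0.
Proof.
move=> s_uniq; have [] := uniq4 s_uniq; have := size_rest4 s_uniq.
move: (rest _) => w sz u1 u2 u3 u4.
rewrite -(@hess_diffE x z (y :: w)) // -(@hess_diffE z y (x :: w)) //.
rewrite -(@hess_diffE y x (z :: w)) //.
have cyc a b c : sg (k :: b :: rcons (c :: w) a) = sg (k :: a :: rcons (b :: w) c).
  rewrite signature_swap_ends // -!cats1.
  rewrite -[k :: a :: _]/([:: k; a] ++ c :: w ++ b :: [::]).
  rewrite /sg (alternating_exchange (@signature_alt _ K) (s1 := [:: k;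
    a])) ?opprK //.
  by rewrite /= size_cat addn1 sz.
rewrite (cyc y z x) (cyc x y z) -!opprD -!mulrDr.
by rewrite cycL ?mulr0 ?oppr0.
Qed.

(** The two signs are opposite, so the difference is a signed sum of four symbols. The left cyclic
    relations [L1] and [L2] bring [x] and [z] together in the left end pair, and the right relation
    [R] merges the two symbols that result. *)
Lemma hess_at_diff x y z : uniq [:: k; x; y; z] ->
  hess_at x y - hess_at z y = hess_diff x z.
Proof.
move=> s_uniq; have [] := uniq4 s_uniq; have := size_rest4 s_uniq.
move: (rest _) => w sz u1 u2 u3 u4.
rewrite -(@hess_atE x y (z :: w)) // -(@hess_atE z y (x :: w)) //.
rewrite -(@hess_diffE x z (y :: w)) //.
have -> : sg (k :: z :: rcons (x :: w) y) = - sg (k :: x :: rcons (z :: w) y).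
  by apply: (@signature_alt _ K [:: k] x z (rcons w y)); rewrite /= size_rcons sz.
have -> : sg (k :: x :: rcons (y :: w) z) = - sg (k :: x :: rcons (z :: w) y).
  rewrite -!cats1.
  rewrite -[k :: x :: (y :: w) ++ _]/([:: k; x] ++ y :: w ++ z :: [::]).
  rewrite /sg (alternating_exchange (@signature_alt _ K) (s1 := [:: k; x])) //.
  by rewrite /= size_cat addn1 sz.
rewrite !mulNr !opprK -mulrDr; congr (_ * _).
have L1 := @cycL x i z w j y sz; have L2 := @cycL x j z w i y sz.
have R := @cycR x z y w i j sz.
rewrite /bracket_hess; move: L1 L2 R.
rewrite (symL i z) (symL j z) !(symL z x) (symR x z (j :: w)) => L1 L2 R.
have comb (l1 l2 r : K) : l1 = 0 -> l2 = 0 -> r = 0 -> l1 + l2 - r = 0.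
  by do 3!move=> ->; ring.
apply/eqP; rewrite -subr_eq0 -(comb _ _ _ L1 L2 R); apply/eqP; ring.
Qed.

Lemma uniq4_of_pairs x y z : uniq [:: k; x; z] -> uniq [:: k; y; z] -> x != y ->
  uniq [:: k; x; y; z].
Proof.
rewrite /= !inE !negb_or !andbT => /andP[/andP[-> ->] ->].
by case/andP=> /andP[-> _] -> ->.
Qed.

(** This is the form A + F(p) + F(q), with F(z) = [hess_diff z x]. The end points are changed one at
    a time by [hess_at_diff]; coincidences with [x] and [y] are treated separately because that
    lemma wants distinct indices. *)
Lemma hess_at_affine x y p q : uniq [:: k; x; y] -> uniq [:: k; p; q] ->
  hess_at p q
  = hess_at x y + hess_diff x y + hess_diff p x + hess_diff q x.
Proof.
move=> xy; have yx : uniq [:: k; y; x] := uniq_swap23 xy.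
have step r : uniq [:: k; r; x] ->
    hess_at r x = hess_at x y + hess_diff x y + hess_diff r x.
  move=> rx; have [->|ry] := eqVneq r y.
    by rewrite (hess_diffC yx) addrK hess_atC.
  have yrx := uniq4_of_pairs rx yx ry.
  have ryx : uniq [:: k; r; x; y].
    by rewrite (perm_uniq (_ : perm_eq _ [:: k; r; y;
      x])) // !perm_cons (perm_catC [:: x] [:: y]).
  have /eqP := hess_at_diff ryx; rewrite subr_eq => /eqP->.
  have /eqP := hess_diff_add ryx; rewrite -addrA addr_eq0 => /eqP->.
  by rewrite (hess_diffC yx) (hess_diffC (uniq_swap23 rx)) (hess_atC yx); ring.
move=> pq; have qp : uniq [:: k; q; p] := uniq_swap23 pq.
have [qx|qx] := eqVneq q x.
  by rewrite qx in pq *; rewrite hess_diffxx addr0 step.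
have [px|px] := eqVneq p x.
  by rewrite px in qp *; rewrite hess_diffxx addr0 -(hess_atC qp) step.
have qx3 : uniq [:: k; q; x].
  by move: qp xy; rewrite /= !inE !negb_or !andbT qx => /andP[/andP[-> _] _]
    /andP[/andP[->]].
have px3 : uniq [:: k; p; x].
  by move: pq xy; rewrite /= !inE !negb_or !andbT px => /andP[/andP[-> _] _]
    /andP[/andP[->]].
have pqx : uniq [:: k; p; q; x].
  by apply: uniq4_of_pairs => //; move: pq; rewrite /= !inE andbT => /andP[].
have /eqP := hess_at_diff pqx; rewrite subr_eq => /eqP->.
by rewrite (hess_atC (uniq_swap23 qx3)) step //; ring.
Qed.

(* Meaningful for sequences of length [m.+2] only. *)
Definition hess_seq (s : seq I) : K :=
  bracket_hess i j (head ord0 s) (take m (behead s)) (last ord0 s).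

Lemma hess_seq_rcons x w y : size w = m ->
  hess_seq (x :: rcons w y) = bracket_hess i j x w y.
Proof. by move=> sz; rewrite /hess_seq /= last_rcons -cats1 take_size_cat. Qed.

Lemma seq_rcons (s : seq I) : size s = m.+2 ->
  exists x w y, s = x :: rcons w y /\ size w = m.
Proof.
case: s => // x s; case/lastP: s => // w y [].
by rewrite size_rcons => -[sz]; exists x, w, y.
Qed.

(** A single rotation of [m.+2] entries has sign (-1)^(m+1), so two have sign 1. *)
Lemma signature_rot2 s l : size s = m.+2 ->
  sg (k :: iter (2 * l) (rot 1) s) = sg (k :: s).
Proof.
move=> sz; elim: l => // l <-; rewrite mulnS iterD.
have: size (iter (2 * l) (rot 1) s) = m.+2.
  by elim: (2 * l)%N => //= p; rewrite size_rot.
move: (iter _ _ s) => t sz_t.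
have step (u : seq I) : size u = m.+2 -> sg (k :: rot 1 u) = (-1) ^+ m.+1 * sg (k
  :: u).
  case: u => // x u [sz_u]; rewrite rot1_cons -cats1.
  rewrite -[in RHS](cats0 u) -[k :: x :: _]/([:: k] ++ x :: u ++ [::]).
  rewrite /sg (alternating_move (@signature_alt _ K)) ?sz_u ?signrMK //.
  by rewrite /= size_cat sz_u addn0.
by rewrite /= !step ?size_rot // signrMK.
Qed.

(** The rotation by [2 * l] starts with entry [2 * l] of the cyclic sequence and ends with entry
    [2 * l - 1], so over all [l] each position is an end point exactly twice. *)
Lemma sum_rot_ends (F : I -> K) s : size s = m.+2 ->
  \sum_(1 <= l < m.+3) (F (head ord0 (iter (2 * l) (rot 1) s))
                        + F (last ord0 (iter (2 * l) (rot 1) s)))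
  = 2%:R * \sum_(z <- s) F z.
Proof.
move=> sz; pose g p := F (head ord0 (iter p (rot 1) s)).
have sz_iter p : size (iter p (rot 1) s) = m.+2.
  by elim: p => //= p IH; rewrite size_rot.
have lastE p : F (last ord0 (iter p.+1 (rot 1) s)) = g p.
  rewrite /g iterS; move: (sz_iter p); case: (iter p _ _) => // x t _.
  by rewrite rot1_cons last_rcons.
have rotE p : (p <= m.+2)%N -> iter p (rot 1) s = rot p s.
  elim: p => [|p IH] le_p; first by rewrite rot0.
  by rewrite iterS IH 1?ltnW // -rotS ?sz.
have gE p : (p < m.+2)%N -> g p = F (nth ord0 s p).
  move=> lt_p; rewrite /g.
  rewrite rotE 1?ltnW //.
  by rewrite -nth0 /rot nth_cat size_drop sz subn_gt0 lt_p nth_drop addn0.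
have g_per p : g (p + m.+2)%N = g p.
  by rewrite /g iterD rotE // rot_oversize // sz.
rewrite (big_nth ord0) sz big_mkord mulr_natl.
rewrite (eq_bigr (fun p : 'I_m.+2 => g p)) => [|p _]; last by rewrite gE.
rewrite -(sum_double_period g_per) !big_add1; apply: eq_bigr => l _.
by rewrite mul2n doubleS lastE.
Qed.

(** Exchanging [y] with the entry at [r] gives an arrangement that ends in this entry; the change of
    signature absorbs the minus sign of [hess_diff]. *)
Lemma hess_diff_subst x w y r : uniq [:: k, x, y & w] -> size w = m -> (r < m)%N ->
  hess_diff x (nth ord0 w r)
  = sg (k :: x :: rcons w y) * T x (nth ord0 w r) (subst_nth w r y) i j.
Proof.
move=> w_uniq sz lt_r; set z := nth _ _ _.
have wE : w = subst_nth w r z by rewrite subst_nth_id ?sz.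
rewrite -(@hess_diffE x z (subst_nth w r y)) ?size_subst_nth ?sz //; last first.
  rewrite (perm_uniq (_ : perm_eq _ [:: k, x, y & w])) // !perm_cons.
  rewrite [in X in perm_eq _ X]wE /subst_nth -!cat_cons; apply/seq.permP=> p /=.
  by rewrite !count_cat /=; ring.
rewrite -mulNr /sg; congr (_ * _); rewrite -!cats1 [in RHS]wE /subst_nth /=.
have := @alternating_exchange _ _ _ _ (@signature_alt m.+3 K) [:: k, x & take r w]
  y (drop r.+1 w) z [::].
rewrite /= -!catA /= => /(_ _) -> //.
have := size_subst_nth y (_ : r < size w)%N; rewrite sz => /(_ lt_r).
by rewrite /subst_nth !size_cat /= size_cat /= addn1 [(_ + _.+2)%N]addnS => ->.
Qed.

(* All rotations sigma^2k are even, so each signed summand is [hess_at] at the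
   two end points. It is affine in the end points, and in the course of the
   sum each element of [a] is an end point exactly twice. *)
Lemma sum_rot_bracket_hess s x w y :
  uniq (k :: s) -> size s = m.+2 -> uniq [:: k, x, y & w] -> size w = m ->
  sg (k :: s) * \sum_(1 <= l < m.+3) hess_seq (iter (2 * l) (rot 1) s)
  = sg (k :: x :: rcons w y) * dbracket_hess i j x w y.
Proof.
move=> s_uniq sz_s w_uniq sz_w.
have xy : uniq [:: k; x; y].
  by move: w_uniq; rewrite -[[:: k, x, y & w]]/([:: k; x;
    y] ++ w) cat_uniq => /andP[].
have ends l : sg (k :: s) * hess_seq (iter (2 * l) (rot 1) s) =
    hess_at x y + hess_diff x y
    + (hess_diff (head ord0 (iter (2 * l) (rot 1) s)) x
       + hess_diff (last ord0 (iter (2 * l) (rot 1) s)) x).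
  rewrite -(signature_rot2 l sz_s).
  have : uniq (k :: iter (2 * l) (rot 1) s).
    by move: s_uniq; elim: (2 * l)%N => // p IH /IH /=; rewrite mem_rot rot_uniq.
  have : size (iter (2 * l) (rot 1) s) = m.+2.
    by elim: (2 * l)%N => //= p IH; rewrite size_rot.
  move=> /seq_rcons[p [u [q [-> sz_u]]]] u_uniq.
  have {}u_uniq : uniq [:: k, p, q & u].
    by rewrite -(perm_uniq (_ : perm_eq (k :: p :: rcons u q) _)) // !perm_cons
      perm_rcons.
  rewrite hess_seq_rcons //= last_rcons hess_atE //.
  rewrite (@hess_at_affine x y) ?addrA //.
  by move: u_uniq; rewrite -[[:: k, p, q & u]]/([:: k; p;
    q] ++ u) cat_uniq => /andP[].
rewrite mulr_sumr (eq_bigr _ (fun l _ => ends l)) big_split /=.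
rewrite sumr_const_nat subSS subn0 (sum_rot_ends (fun z => hess_diff z x) sz_s).
have -> : \sum_(z <- s) hess_diff z x = \sum_(z <- [:: x, y & w]) hess_diff z x.
  apply: perm_big; rewrite (perm_trans (_ : perm_eq _ (rest [:: k]))) //.
    by apply: perm_rest; rewrite //= sz_s.
  by rewrite perm_sym; apply: perm_rest; rewrite //= sz_w.
rewrite !big_cons hess_diffxx add0r (hess_diffC (uniq_swap23 xy)).
rewrite (big_nth ord0) sz_w big_mkord /dbracket_hess [RHS]mulrDr [in RHS]mulrCA
  hess_atE //.
rewrite [X in _ = _ + X]mulr_sumr.
(* With [z] the entry at [r], the summand is [hess_diff z y + hess_diff z x], and [hess_diff_add]
   replaces [hess_diff z y] by [hess_diff x y + hess_diff z x]. *)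
rewrite [X in _ = _ + X](eq_bigr (fun r : 'I_m =>
  hess_diff x y + 2%:R * hess_diff (nth ord0 w r) x)) => [|r _]; last first.
  have zP : uniq [:: k; x; y; nth ord0 w r].
    move: w_uniq; rewrite -[in X in X -> _](subst_nth_id ord0 (_ : r < size w)%N)
      ?sz_w //.
    rewrite (perm_uniq (_ : perm_eq _ ([:: k; x; y;
      nth ord0 w r] ++ take r w ++ drop r.+1 w))).
      by rewrite cat_uniq => /andP[].
    by rewrite !perm_cons (perm_catCA _ [:: _]).
  have := hess_diff_add zP; rewrite (hess_diffC (uniq_swap23 xy)).
  move: zP; set z := nth _ _ _ => zP.
  have kxz : uniq [:: k; x; z] by exact: (mask_uniq zP [:: true; true; false; true]).
  have kyz : uniq [:: k; y; z] by exact: (mask_uniq zP [:: true; false; true; true]).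
  have yx_uniq := uniq_swap23 w_uniq.
  have dx := hess_diff_subst w_uniq sz_w (ltn_ord r).
  have dy := hess_diff_subst yx_uniq sz_w (ltn_ord r).
  rewrite signature_swap_ends // mulNr -/z in dy; rewrite -/z in dx.
  rewrite mulrBr -dx -[sg _ * _]opprK -dy (hess_diffC (uniq_swap23 kxz))
    (hess_diffC (uniq_swap23 kyz)).
  move=> E; apply/eqP; rewrite -subr_eq0 -E; apply/eqP; ring.
rewrite big_split /= sumr_const card_ord -mulr_sumr.
(* The end point [y] takes 2 [hess_diff x y] away from the [m.+2] copies on the left, which leaves
   the [m] copies on the right. *)
move: (\sum_(_ < m) _) (hess_at x y) (hess_diff x y) => S A B.
rewrite mulrnDl -(mulr_natl A) -addrA; congr (_ + _).
by rewrite !mulrS; move: (B *+ m) => mB; ring.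
Qed.

End Rotations.

End SymbolAlgebra.

(** * Structure constants from the closed form of the Hessians *)

Section StructureConstants.

Variables (K : comNzRingType) (m : nat).
Local Notation I := 'I_m.+3.
Local Notation sg := (@signature m.+3 K).
Variables (T : I -> I -> seq I -> I -> I -> K) (TP : symbol_relations T).
Variable c : I -> I -> I -> K.
Hypothesis cP : forall k i j x w y, uniq [:: k, x, y & w] -> size w = m ->
  (2 * m.+4)%:R * c k i j = - (sg (k :: x :: rcons w y) * dbracket_hess T i j x w y).
Hypothesis reg : GRing.lreg ((2 * m.+4)%:R : K).

Variables (i j k : I) (w : seq I).
Hypotheses (ijk : uniq [:: i, j, k & w]) (sz : size w = m).

Let perm_uniq_ijk s : perm_eq s [:: i, j, k & w] -> uniq s.
Proof. by move/perm_uniq->. Qed.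

Let kij : uniq [:: k, i, j & w].
Proof. by apply: perm_uniq_ijk; apply/seq.permP => p /=; ring. Qed.

Let jik : uniq [:: j, i, k & w].
Proof. by apply: perm_uniq_ijk; apply/seq.permP => p /=; ring. Qed.

Let kji : uniq [:: k, j, i & w].
Proof. by apply: perm_uniq_ijk; apply/seq.permP => p /=; ring. Qed.

Let dbracket_hess_ends p q x : bracket_hess T p q x w x = 0 -> dbracket_hess T p q
  x w x = 0.
Proof. by move=> h; apply: dbracket_hess_diag; rewrite // h mulr0. Qed.

Let signature_swap_first_last a b d : sg (a :: d :: rcons w b) = - sg (b :: d ::
  rcons w a).
Proof.
rewrite -!cats1.
have := @alternating_exchange _ _ _ _ (@signature_alt m.+3 K) [::] b (d :: w) a [::].
by rewrite /= => -> //; rewrite size_cat addn1 sz.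
Qed.

(** At [i i w j j] the four summands of [symbolE] coincide. *)
Lemma structure_constant_ijk :
  4%:R * c k i j = - sg (k :: i :: rcons w j) * T i i w j j.
Proof.
apply: reg; rewrite mulrCA (cP i j kij sz).
rewrite mulrCA -(symbolE TP) // mulNr; ring.
Qed.

(** At [i i w k i] two summands of [symbolE] agree, and the other two vanish because both their end
    points are [i]. *)
Lemma structure_constant_jii :
  2%:R * c j i i = - sg (j :: i :: rcons w k) * T i i w k i.
Proof.
have E0 : dbracket_hess T i k i w i = 0.
  apply: dbracket_hess_ends; rewrite /bracket_hess.
  by rewrite (@symbol_rev _ _ _ TP i i w i k) // (symbol_symR TP _ _ _ i k) addrN.
apply: reg; rewrite mulrCA (cP i i jik sz).
rewrite mulrCA -(symbolE TP) // E0; ring.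
Qed.

(** At [i i w j k] the summands of [symbolE] form two equal pairs, one for each constant; exchanging
    [j] and [k] in the signature turns the sum into a difference. *)
Lemma structure_constant_ijj_ikk :
  2%:R * (c j i j - c k i k) = - sg (j :: i :: rcons w k) * T i i w j k.
Proof.
apply: reg; rewrite mulrCA mulrBr (cP i j jik sz) (cP i k kij sz).
have -> : sg (k :: i :: rcons w j) = - sg (j :: i :: rcons w k).
  exact: signature_swap_first_last.
rewrite mulrCA -(symbolE TP) //; ring.
Qed.

(** At [i j w k i] the summand of [symbolE] with both end points [i] vanishes, and the other three
    belong to the three constants. *)
Lemma structure_constant_iii :
  c i i i - c j i j - c k i k = - sg (i :: j :: rcons w k) * T i j w k i.
Proof.
have E0 : dbracket_hess T j k i w i = 0.
  apply: dbracket_hess_ends; rewrite /bracket_hess.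
  rewrite (@symbol_rev _ _ _ TP j i w i k) // (symbol_symR TP j i) (symbol_symL TP
    j).
  by rewrite addrN.
apply: reg; rewrite !mulrBr (cP i i ijk sz) (cP i j jik sz) (cP i k kji sz).
have -> : sg (k :: j :: rcons w i) = - sg (i :: j :: rcons w k).
  exact: signature_swap_first_last.
have -> : sg (j :: i :: rcons w k) = - sg (i :: j :: rcons w k).
  by apply: (@signature_alt _ K [::]); rewrite /= size_rcons sz.
by rewrite mulrCA -(symbolE TP) // E0 (dbracket_hessC TP j i); ring.
Qed.

End StructureConstants.

(** * Signs that do not depend on the field *)

Section SequenceSign.

Variable d : nat.
Implicit Types s : seq 'I_d.

(** A boolean exponent, not an element of [K]: the signs in the theorem are fixed before the field
    is introduced. *)
Definition seq_sign s : bool :=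
  if [pick sigma : 'S_d | codom sigma == s] is Some sigma then odd_perm sigma else
    false.

Lemma seq_signE (K : comNzRingType) s : uniq s -> size s = d ->
  signature K s = (-1) ^+ seq_sign s.
Proof.
move=> s_uniq sz; rewrite /seq_sign; case: pickP => [sigma /eqP <-|no_sigma].
  by rewrite signature_codom.
by have [sigma /eqP] := exists_codom s_uniq sz; rewrite no_sigma.
Qed.

Lemma opp_seq_signE (K : comNzRingType) s : uniq s -> size s = d ->
  - signature K s = (-1) ^+ (~~ seq_sign s).
Proof. by move=> s_uniq sz; rewrite seq_signE // signrN. Qed.

(** Indices start at 0, so [k] passes exactly [k] smaller ones on its way to the front. *)
Lemma signature_cons_delete (K : comNzRingType) (k : 'I_d) :
  signature K (k :: [seq a <- enum 'I_d | a \notin [:: k]]) = (-1) ^+ k.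
Proof.
have -> : [seq a <- enum 'I_d | a \notin [:: k]] =
    take k (enum 'I_d) ++ drop k.+1 (enum 'I_d).
  rewrite -{1 2}(index_enum_ord k) -remE rem_filter ?enum_uniq //.
  by apply: eq_filter => a; rewrite inE.
have szk : size (take k (enum 'I_d)) = k by rewrite size_take size_enum_ord ltn_ord.
have enumE : take k (enum 'I_d) ++ k :: drop k.+1 (enum 'I_d) = enum 'I_d.
  by rewrite -[RHS](cat_take_drop k) [drop k _](drop_nth k) ?size_enum_ord //
    nth_ord_enum.
rewrite (alternating_cons (@signature_alt d K)) ?szk ?enumE; last first.
  by rewrite -[RHS](size_enum_ord d) -[in RHS]enumE /= !size_cat addnS.
have <- : codom (1%g : 'S_d) = enum 'I_d.
  by rewrite /codom /image_mem; rewrite (eq_map (fun i => perm1 i)) map_id.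
by rewrite signature_codom odd_perm1 mulr1.
Qed.

End SequenceSign.
(** * Products of chains of matrices *)

Section Chains.

Variables (S : comNzRingType) (r : nat -> nat).
Implicit Types A B : forall k, 'M[S]_(r k, r k.+1).

Lemma eq_chain_mul A B N : (forall k, (k < N)%N -> A k = B k) ->
  chain_mul A N = chain_mul B N.
Proof.
elim: N => //= N IH AB; rewrite AB // IH // => k lt_k.
by rewrite AB // ltnW.
Qed.

Lemma chain_mul0 A p N : (p < N)%N -> A p = 0 -> chain_mul A N = 0.
Proof.
elim: N => //= N IH; rewrite ltnS leq_eqVlt => /predU1P[->|lt_p] Ap.
  by rewrite Ap mulmx0.
by rewrite IH ?mul0mx.
Qed.

Lemma chain_mul_scale A B (z : nat -> S) N :
  (forall k, (k < N)%N -> A k = z k *: B k) ->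
  chain_mul A N = (\prod_(k < N) z k) *: chain_mul B N.
Proof.
elim: N => [|N IH] AB /=; first by rewrite big_ord0 scale1r.
rewrite big_ord_recr /= AB // IH => [|k lt_k]; last by rewrite AB // ltnW.
by rewrite -scalemxAl -scalemxAr scalerA.
Qed.

(** The chains agree outside two consecutive factors, so the vanishing sum of products can be
    factored out. In this way an identity between consecutive differentials becomes a relation
    between symbols. *)
Lemma chain_mul_cancel (J : Type) (js : seq J) (A : J -> forall k, 'M[S]_(r k, r
  k.+1))
    B p N :
  (p.+1 < N)%N ->
  (forall j k, k != p -> k != p.+1 -> (k < N)%N -> A j k = B k) ->
  \sum_(j <- js) A j p *m A j p.+1 = 0 ->
  \sum_(j <- js) chain_mul (A j) N = 0.
Proof.
elim: N => // N IH; rewrite ltnS leq_eqVlt => /predU1P[<-|lt_p] AB sum0 /=.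
  rewrite (eq_bigr (fun j => chain_mul B p *m (A j p *m A j p.+1))) => [|j _].
    by rewrite -mulmx_sumr sum0 mulmx0.
  rewrite mulmxA (@eq_chain_mul (A j) B) // => k lt_k.
  by rewrite AB ?ltn_eqF // ltnW // leqW.
rewrite (eq_bigr (fun j => chain_mul (A j) N *m B N)) => [|j _].
  by rewrite -mulmx_suml IH ?mul0mx // => j k kp kp1 lt_k; rewrite AB // ltnW.
by rewrite AB ?gtn_eqF // ltnW.
Qed.

(* Each factor of A is moved past the pairing M, where it becomes a factor
   of B; this reverses the order of the factors. *)
Lemma chain_mul_reverse A B (M : forall i j, 'M[S]_(r i, r j)) N :
  (forall i j, (i + j.+1)%N = N ->
     (A i)^T *m M i j.+1 = (-1) ^+ i *: (M i.+1 j *m B j)) ->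
  (chain_mul A N)^T *m M 0%N N
  = (-1) ^+ (\sum_(i < N) i)%N *: (M N 0%N *m chain_mul B N).
Proof.
(* [Z] is the product of the factors from [A i] on; the induction extends it to the left. *)
move=> MP; suff tail j i : (i + j = N)%N -> exists Z : 'M[S]_(r i, r N),
    chain_mul A N = chain_mul A i *m Z
    /\ Z^T *m M i j
       = (-1) ^+ (\sum_(i <= p < N) p)%N *: (M N 0%N *m chain_mul B j).
  have [Z [-> E]] := tail N 0%N (erefl _).
  by rewrite /= mul1mx E big_mkord.
elim: j i => [|j IH] i ijN.
  move: ijN; rewrite addn0 => <-; exists 1%:M.
  by rewrite mulmx1 trmx1 mul1mx mulmx1 big_geq // scale1r.
have [Z [AZ E]] := IH i.+1 (etrans (addSnnS _ _) ijN).
exists (A i *m Z); split; first by rewrite AZ -mulmxA.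
rewrite trmx_mul -mulmxA MP // -scalemxAr mulmxA E -scalemxAl scalerA -exprD.
have lt_i : (i < N)%N by rewrite -ijN addnS ltnS leq_addr.
by rewrite [in RHS]big_ltn //= mulmxA.
Qed.

Lemma map_chain_mul (S' : comNzRingType) (f : {rmorphism S -> S'}) A N :
  map_mx f (chain_mul A N) = chain_mul (fun k => map_mx f (A k)) N.
Proof. by elim: N => [|N IH] /=; rewrite ?map_mx1 // map_mxM IH. Qed.

Lemma chain_mul_deriv (f : {additive S -> S}) A N :
  (forall a c, f (a * c) = f a * c + a * f c) -> f 1 = 0 ->
  map_mx f (chain_mul A N)
  = \sum_(p < N) chain_mul (fun k => if k == p then map_mx f (A k) else A k) N.
Proof.
move=> fM f1; elim: N => [|N IH] /=.
  rewrite big_ord0; apply/matrixP=> i j; rewrite !mxE.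
  by case: (i == j); rewrite ?f1 ?raddf0.
have -> : map_mx f (chain_mul A N *m A N)
    = map_mx f (chain_mul A N) *m A N + chain_mul A N *m map_mx f (A N).
  apply/matrixP=> i j; rewrite !mxE raddf_sum -big_split /=.
  by apply: eq_bigr => l _; rewrite fM !mxE.
rewrite big_ord_recr /= IH mulmx_suml; congr (_ + _).
  by apply: eq_bigr => p _; rewrite gtn_eqF.
by rewrite eqxx; congr (_ *m _); apply: eq_chain_mul => k lt_k; rewrite ltn_eqF.
Qed.

End Chains.

Section FullProduct.

Variables (S : comNzRingType) (n : nat).
Implicit Types A B : forall k, 'M[S]_(betti n k, betti n k.+1).

Let i0 := cast_ord (esym (betti_first n)) 0.
Let j0 := cast_ord (esym (betti_last n)) 0.

Lemma full_productE A : full_product A = chain_mul A n.-2 i0 j0.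
Proof. by rewrite /full_product castmxE. Qed.

Lemma eq_full_product A B : (forall k, (k < n.-2)%N -> A k = B k) ->
  full_product A = full_product B.
Proof. by move=> AB; rewrite !full_productE (eq_chain_mul AB). Qed.

Lemma full_product0 A p : (p < n.-2)%N -> A p = 0 -> full_product A = 0.
Proof. by move=> lt_p Ap; rewrite full_productE (chain_mul0 lt_p Ap) mxE. Qed.

Lemma full_product_scale A B (z : nat -> S) :
  (forall k, (k < n.-2)%N -> A k = z k *: B k) ->
  full_product A = (\prod_(k < n.-2) z k) * full_product B.
Proof. by move=> AB; rewrite !full_productE (chain_mul_scale AB) mxE. Qed.

Lemma full_product_cancel (J : Type) (js : seq J)
    (A : J -> forall k, 'M[S]_(betti n k, betti n k.+1)) B p :
  (p.+1 < n.-2)%N ->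
  (forall j k, k != p -> k != p.+1 -> (k < n.-2)%N -> A j k = B k) ->
  \sum_(j <- js) A j p *m A j p.+1 = 0 ->
  \sum_(j <- js) full_product (A j) = 0.
Proof.
move=> lt_p AB sum0; under eq_bigr do rewrite full_productE.
by rewrite -summxE (chain_mul_cancel lt_p AB sum0) mxE.
Qed.

Lemma full_product_reverse A B (M : forall i j, 'M[S]_(betti n i, betti n j)) :
  (forall i j, (i + j.+1)%N = n.-2 ->
     (A i)^T *m M i j.+1 = (-1) ^+ i *: (M i.+1 j *m B j)) ->
  (forall a c, M 0%N n.-2 a c = 1) -> (forall a c, M n.-2 0%N a c = 1) ->
  full_product A = (-1) ^+ (\sum_(i < n.-2) i)%N * full_product B.
Proof.
move=> MP M0N MN0; have /matrixP/(_ j0 j0) := chain_mul_reverse MP.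
have i0P (i : 'I_(betti n 0)) : i = i0.
  by apply: val_inj; case: i => -[].
have j0P (i : 'I_(betti n n.-2)) : i = j0.
  by move: i (j0); rewrite betti_last => i j; rewrite !ord1.
have sum1 (F : 'I_(betti n 0) -> S) : \sum_i F i = F i0.
  by rewrite (bigD1 i0) //= big1 ?addr0 // => i; rewrite (i0P i) eqxx.
by rewrite !mxE !sum1 M0N MN0 mulr1 mul1r mxE -!full_productE.
Qed.

Lemma full_product_deriv (f : {additive S -> S}) A :
  (forall a c, f (a * c) = f a * c + a * f c) -> f 1 = 0 ->
  f (full_product A)
  = \sum_(p < n.-2) full_product (fun k => if k == p then map_mx f (A k) else A k).
Proof.
move=> fM f1; under eq_bigr do rewrite full_productE.
by rewrite full_productE -summxE -chain_mul_deriv // mxE.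
Qed.

End FullProduct.

Lemma map_full_product (S S' : comNzRingType) (n : nat) (f : {rmorphism S -> S'})
    (A : forall k, 'M[S]_(betti n k, betti n k.+1)) :
  f (full_product A) = full_product (fun k => map_mx f (A k)).
Proof. by rewrite !full_productE -(map_chain_mul f A) mxE. Qed.
(** * Multiplication on the resolution *)

Section Multiplication.

Variables (R : comNzRingType) (b : nat -> nat) (phi : forall k, 'M[R]_(b k, b k.+1)).

Hypothesis b0 : b 0%N = 1%N.
Hypothesis phi_exact : forall k (v : 'cV[R]_(b k.+1)),
  phi k *m v = 0 <-> exists w, v = phi k.+1 *m w.

Let eq_b0 (a a' : 'I_(b 0)) : a = a'.
Proof. by move: a a'; rewrite b0 => a a'; rewrite !ord1. Qed.

Let phiphi k (w : 'cV[R]_(b k.+2)) : phi k *m (phi k.+1 *m w) = 0.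
Proof. by apply/phi_exact; exists w. Qed.

Definition bilinear_ext p q r (f : 'I_p -> 'I_q -> 'cV[R]_r)
    (u : 'cV[R]_p) (v : 'cV[R]_q) : 'cV[R]_r :=
  \sum_a \sum_c (u a 0 * v c 0) *: f a c.

(** A chosen preimage under [phi k], meaningful only if [z] lies in the image. *)
Definition lift_cycle k (z : 'cV[R]_(b k)) : 'cV[R]_(b k.+1) :=
  epsilon (inhabits 0) (fun w => z = phi k *m w).

(* [basis_mul k i j] is the part F_i x F_j -> F_k of a multiplication on the
   resolution, to be used for k = i + j only. *)
Fixpoint basis_mul (k : nat) : forall i j, 'I_(b i) -> 'I_(b j) -> 'cV[R]_(b k) :=
  match k with
  | 0 => fun i j a c => const_mx 1
  | k'.+1 => fun i j =>
    match i, j return 'I_(b i) -> 'I_(b j) -> 'cV[R]_(b k'.+1) with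
    | 0, _ => fun a c => \col_e (e == c :> nat)%:R
    | _, 0 => fun a c => \col_e (e == a :> nat)%:R
    | i'.+1, j'.+1 => fun a c =>
        lift_cycle (bilinear_ext (@basis_mul k' i' j'.+1) (col a (phi i'))
          (delta_mx c 0)
          + (-1) ^+ i'.+1 *: bilinear_ext (@basis_mul k' i'.+1 j') (delta_mx a 0)
            (col c (phi j')))
    end
  end.

Definition mul k i j := bilinear_ext (@basis_mul k i j).

Lemma bilinear_ext_delta p q r (f : 'I_p -> 'I_q -> 'cV[R]_r) a c :
  bilinear_ext f (delta_mx a 0) (delta_mx c 0) = f a c.
Proof.
rewrite /bilinear_ext (bigD1 a) //= (bigD1 c) //= !mxE !eqxx mulr1 scale1r.
rewrite [X in _ + X + _]big1 ?addr0 => [|c' /negPf c'c];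
  last by rewrite !mxE c'c mulr0 scale0r.
rewrite big1 ?addr0 // => a' /negPf a'a; apply: big1 => c' _.
by rewrite !mxE a'a mul0r scale0r.
Qed.

Lemma bilinear_ext0l p q r (f : 'I_p -> 'I_q -> 'cV[R]_r) v : bilinear_ext f 0 v = 0.
Proof.
by apply: big1 => a _; apply: big1 => c _; rewrite mxE mul0r scale0r.
Qed.

Lemma bilinear_ext0r p q r (f : 'I_p -> 'I_q -> 'cV[R]_r) u : bilinear_ext f u 0 = 0.
Proof.
by apply: big1 => a _; apply: big1 => c _; rewrite mxE mulr0 scale0r.
Qed.

Lemma bilinear_ext_suml p q r (f : 'I_p -> 'I_q -> 'cV[R]_r) s (g : 'I_s -> R) (u :
  'I_s -> 'cV[R]_p) v :
  bilinear_ext f (\sum_a g a *: u a) v = \sum_a g a *: bilinear_ext f (u a) v.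
Proof.
rewrite /bilinear_ext; under [RHS]eq_bigr do rewrite scaler_sumr.
rewrite [RHS]exchange_big; apply: eq_bigr => a _.
under [RHS]eq_bigr do rewrite scaler_sumr.
rewrite [RHS]exchange_big; apply: eq_bigr => c _ /=;
  rewrite summxE mulr_suml scaler_suml.
by apply: eq_bigr => e _; rewrite !mxE scalerA mulrA.
Qed.

Lemma bilinear_ext_sumr p q r (f : 'I_p -> 'I_q -> 'cV[R]_r) s (g : 'I_s -> R) u (v
  : 'I_s -> 'cV[R]_q) :
  bilinear_ext f u (\sum_a g a *: v a) = \sum_a g a *: bilinear_ext f u (v a).
Proof.
rewrite /bilinear_ext; under [RHS]eq_bigr do rewrite scaler_sumr.
rewrite [RHS]exchange_big; apply: eq_bigr => a _.
under [RHS]eq_bigr do rewrite scaler_sumr.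
rewrite [RHS]exchange_big; apply: eq_bigr => c _ /=;
  rewrite summxE mulr_sumr scaler_suml.
by apply: eq_bigr => e _; rewrite !mxE scalerA mulrCA.
Qed.

Lemma col_delta p (v : 'cV[R]_p) : v = \sum_a v a 0 *: delta_mx a 0.
Proof. by rewrite {1}[v]matrix_sum_delta; apply: eq_bigr => a _;
  rewrite big_ord1. Qed.

Lemma mul_1l k (u : 'cV[R]_(b 0)) (v : 'cV[R]_(b k)) a : mul k u v = u a 0 *: v.
Proof.
rewrite /mul /bilinear_ext (bigD1 a) //= [X in _ + X]big1 ?addr0; last first.
  by move=> a'; rewrite (eq_b0 a' a) eqxx.
rewrite {2}[v]col_delta scaler_sumr; apply: eq_bigr => c _.
rewrite scalerA; congr (_ *: _); case: k v c => [|k] v c /=.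
  by apply/colP=> e; rewrite !mxE (eq_b0 e c) eqxx.
by apply/colP=> e; rewrite !mxE andbT.
Qed.

Lemma mul_1r k (u : 'cV[R]_(b k)) (v : 'cV[R]_(b 0)) a : mul k u v = v a 0 *: u.
Proof.
rewrite /mul /bilinear_ext {2}[u]col_delta scaler_sumr.
apply: eq_bigr => c _; rewrite (bigD1 a) //= [X in _ + X]big1 ?addr0; last first.
  by move=> a'; rewrite (eq_b0 a' a) eqxx.
rewrite scalerA [u c 0 * _]mulrC; congr (_ *: _); case: k u c => [|k] u c /=.
  by apply/colP=> e; rewrite !mxE (eq_b0 e c) eqxx.
by apply/colP=> e; rewrite !mxE andbT.
Qed.

Lemma lift_cycleP k (z : 'cV[R]_(b k.+1)) : phi k *m z = 0 ->
  phi k.+1 *m lift_cycle z = z.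
Proof. by move/phi_exact => h; exact: (esym (epsilon_spec (inhabits 0) _ h)). Qed.

Lemma mul_deltaE k i j (a : 'I_(b i.+1)) (c : 'I_(b j.+1)) :
  mul k.+1 (delta_mx a 0) (delta_mx c 0)
  = lift_cycle (mul k (phi i *m delta_mx a 0) (delta_mx c 0)
       + (-1) ^+ i.+1 *: mul k (delta_mx a 0) (phi j *m delta_mx c 0)).
Proof. by rewrite {1}/mul bilinear_ext_delta /= !colE. Qed.

(** The Leibniz rule. On basis elements the product is defined as a lift of the right-hand side, so
    by exactness it suffices that this side is a cycle; bilinearity does the rest. *)
Lemma phi_mul k (i j : nat) (u : 'cV[R]_(b i.+1)) (v : 'cV[R]_(b j.+1)) :
  (i + j = k)%N ->
  phi k.+1 *m mul k.+2 u v
  = mul k.+1 (phi i *m u) v + (-1) ^+ i.+1 *: mul k.+1 u (phi j *m v).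
Proof.
elim/ltn_ind: k => k IH in i j u v *; move=> ijk; move: u v.
(* By induction and phi phi = 0, both terms have boundary plus or minus phi(p) phi(q), with opposite
   signs. If [i] or [j] is 0, a factor lies in F_0 = R and acts as a scalar. *)
have cycle p q : phi k *m (mul k.+1 (phi i *m p) q
    + (-1) ^+ i.+1 *: mul k.+1 p (phi j *m q)) = 0.
  have a : 'I_(b 0) by rewrite b0; exact: ord0.
  have left_term : phi k *m mul k.+1 (phi i *m p) q
      = (-1) ^+ i *: mul k (phi i *m p) (phi j *m q).
    case: i p ijk {IH} (IH) => [|i] p ijk IH.
      by move: ijk q; rewrite add0n => -> q;
        rewrite !(mul_1l _ _ a) -scalemxAr expr0 scale1r.
    case: k ijk IH => // k [ijk] IH; rewrite IH // phiphi /mul bilinear_ext0l add0r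
      //.
  have right_term : phi k *m mul k.+1 p (phi j *m q)
      = mul k (phi i *m p) (phi j *m q).
    case: j q ijk {left_term IH} (IH) => [|j] q ijk IH.
      by move: ijk p; rewrite addn0 => -> p; rewrite !(mul_1r _ _ a) -scalemxAr.
    move: ijk; rewrite addnS; case: k IH => // k IH [ijk].
    by rewrite IH // phiphi /mul bilinear_ext0r scaler0 addr0.
  by rewrite mulmxDr -scalemxAr left_term right_term exprS mulN1r scaleNr subrr.
have linM p q s (A : 'M[R]_(p, q)) (g : 'I_s -> R) (h : 'I_s -> 'cV[R]_q) :
    A *m (\sum_a g a *: h a) = \sum_a g a *: (A *m h a).
  by rewrite mulmx_sumr; apply: eq_bigr => a _; rewrite scalemxAr.
move=> u v; rewrite [u]col_delta /mul linM !bilinear_ext_suml linM scaler_sumr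
  -big_split /=.
apply: eq_bigr => a _; rewrite scalerA mulrC -scalerA -scalerDr; congr (_ *: _).
rewrite [v]col_delta linM !bilinear_ext_sumr linM scaler_sumr -big_split /=.
apply: eq_bigr => c _; rewrite scalerA mulrC -scalerA -scalerDr; congr (_ *: _).
by rewrite -!/(mul _ _ _) mul_deltaE lift_cycleP.
Qed.

Variable N : nat.
Hypotheses (bN : b N = 1%N) (bN1 : b N.+1 = 0%N).

(* The product F_i x F_j -> F_N = R, for i + j = N. *)
Definition pairing i j : 'M[R]_(b i, b j) :=
  \matrix_(a, c) basis_mul N a c (cast_ord (esym bN) 0) 0.

(** A product of elements of F_(i+1) and F_(j+1) lies in F_(N+1) = 0, so the Leibniz rule becomes an
    adjunction between the two differentials. *)
Lemma pairing_phi i j : (i + j.+1 = N)%N ->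
  (phi i)^T *m pairing i j.+1 = (-1) ^+ i *: (pairing i.+1 j *m phi j).
Proof.
move=> ijN; have adj (u : 'cV[R]_(b i.+1)) (v : 'cV[R]_(b j.+1)) :
    mul N (phi i *m u) v = (-1) ^+ i *: mul N u (phi j *m v).
  move: bN1 ijN; case: (N) => [|M] bM; first by rewrite addnS.
  rewrite addnS => -[/(phi_mul u v)]; rewrite exprS mulN1r scaleNr => /eqP.
  rewrite (_ : phi M.+1 *m _ = 0); first by rewrite eq_sym subr_eq0 => /eqP.
  by move: (mul _ _ _) (phi M.+1); rewrite bM => w A; apply/colP=> e;
    rewrite !mxE big_ord0.
apply/matrixP=> a c; rewrite !mxE.
have /colP/(_ (cast_ord (esym bN) 0)) := adj (delta_mx a 0) (delta_mx c 0).
rewrite [phi i *m _]col_delta [phi j *m _]col_delta /mul bilinear_ext_suml.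
rewrite bilinear_ext_sumr summxE mxE summxE => E.
apply: etrans (etrans _ E) _; last congr (_ * _); apply: eq_bigr => e _.
  by rewrite bilinear_ext_delta -colE !mxE.
by rewrite bilinear_ext_delta -colE !mxE mulrC.
Qed.

Lemma pairing_0N a c : pairing 0 N a c = 1.
Proof.
rewrite mxE; have eq1 (e e' : 'I_(b N)) : e = e'.
  by move: e e'; rewrite bN => e e'; rewrite !ord1.
move: a c eq1 (cast_ord _ _); case: (N) => [|M] a c eq1 e; rewrite mxE //.
by rewrite (eq1 e c) eqxx.
Qed.

Lemma pairing_N0 a c : pairing N 0 a c = 1.
Proof.
rewrite mxE; have eq1 (e e' : 'I_(b N)) : e = e'.
  by move: e e'; rewrite bN => e e'; rewrite !ord1.
move: a c eq1 (cast_ord _ _); case: (N) => [|M] a c eq1 e; rewrite mxE //.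
by rewrite (eq1 e a) eqxx.
Qed.

End Multiplication.
(** * Symbols of a resolution *)

Section ConstantTerm.

Variables (K : fieldType) (d : nat).
Local Notation R := {mpoly K[d]}.
Implicit Types (f g : R) (x y z : 'I_d).

Lemma mderiv_homog e x f : f \is e.+1.-homog -> f^`M(x) \is e.-homog.
Proof.
move=> /dhomogP f_homog; apply/dhomogP => mu; rewrite mcoeff_msupp mcoeff_deriv.
move=> nz; suff: mdeg (mu + U_(x))%MM = e.+1 by rewrite mdegD mdeg1 addn1 => -[].
by apply: f_homog; rewrite mcoeff_msupp; apply: contraNneq nz => ->; rewrite mul0rn.
Qed.

Lemma homog0_const f : f \is 0.-homog -> f = (f@_0%MM)%:MP.
Proof.
move=> /dhomogP f_homog; apply/mpolyP=> mu; rewrite mcoeffC.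
have [->|mu0] := eqVneq mu 0%MM; first by rewrite mulr1.
rewrite mulr0; apply: memN_msupp_eq0.
by apply: contra_neqN mu0 => /f_homog /eqP; rewrite mdeg_eq0 => /eqP.
Qed.

Lemma mderiv_homog0 x f : f \is 0.-homog -> f^`M(x) = 0.
Proof. by move/homog0_const=> ->; rewrite mderivC. Qed.

Lemma homog_const_term e f : f \is e.+1.-homog -> f@_0%MM = 0.
Proof.
by move=> f_homog; apply: (dhomog_nemf_coeff f_homog); rewrite mf0.
Qed.

Lemma const_mderiv2_sum x y (J : Type) (r : seq J) (P : pred J) (F : J -> R) :
  ((\sum_(j <- r | P j) F j)^`M(x)^`M(y))@_0%MM
  = \sum_(j <- r | P j) ((F j)^`M(x)^`M(y))@_0%MM.
Proof. exact: (raddf_sum (mcoeff 0%MM \o mderiv y \o mderiv x)). Qed.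

Lemma const_mderiv3_sum x y z (J : Type) (r : seq J) (P : pred J) (F : J -> R) :
  ((\sum_(j <- r | P j) F j)^`M(x)^`M(y)^`M(z))@_0%MM
  = \sum_(j <- r | P j) ((F j)^`M(x)^`M(y)^`M(z))@_0%MM.
Proof. exact: (raddf_sum (mcoeff 0%MM \o mderiv z \o mderiv y \o mderiv x)). Qed.

Lemma const_mderivM x f g : f@_0%MM = 0 ->
  ((f * g)^`M(x))@_0%MM = (f^`M(x))@_0%MM * g@_0%MM.
Proof. by move=> f0; rewrite mderivM mcoeffD !rmorphM /= f0 mul0r addr0. Qed.

Lemma const_mderiv2M x y f g : f@_0%MM = 0 ->
  ((f * g)^`M(x)^`M(y))@_0%MM
  = (f^`M(x)^`M(y))@_0%MM * g@_0%MM
    + (f^`M(x))@_0%MM * (g^`M(y))@_0%MM + (f^`M(y))@_0%MM * (g^`M(x))@_0%MM.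
Proof.
move=> f0; rewrite mderivM mderivD !mderivM !mcoeffD !rmorphM /= f0 mul0r.
by rewrite addr0.
Qed.

End ConstantTerm.

(** * Relations between the polar symbols of a resolution *)

Section Resolution.

Variables (K : fieldType) (m : nat).
Local Notation R := {mpoly K[m.+3]}.
Variables (I : R -> Prop) (phi : forall k, 'M[R]_(betti m.+4 k, betti m.+4 k.+1)).
Hypothesis phi_mfr : @minimal_free_resolution K m.+4 I phi.

Local Notation V := 'I_m.+3.
Local Notation const := (@mcoeff m.+3 K 0%MM).
Implicit Types (D : nat -> R -> R) (a b c e x y z : V).

Let phi_mul0 k : phi k *m phi k.+1 = 0.
Proof.
apply/matrixP=> a b; have /matrixP/(_ a 0) : phi k *m col b (phi k.+1) = 0.
  by apply/(mfr_exact phi_mfr); exists (delta_mx b 0); rewrite colE.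
by rewrite colE mulmxA -colE !mxE.
Qed.

Let const_phi k i j : const (phi k i j) = 0.
Proof. exact: (mfr_minimal phi_mfr). Qed.

Let phi_homog0 i j : phi 0%N i j \is 2.-homog.
Proof. exact: (mfr_graded phi_mfr i j). Qed.

Let phi_homog_last i j : phi m.+1 i j \is 2.-homog.
Proof.
have := mfr_graded phi_mfr i j; rewrite /shift /= eqxx ltn_eqF //.
by rewrite -[m.+4]/(2 + m.+2)%N addnK.
Qed.

Let phi_homog_mid k i j : (0 < k <= m)%N -> phi k i j \is 1.-homog.
Proof.
case/andP=> k_gt0 le_k; have := mfr_graded phi_mfr i j; rewrite /shift /=.
rewrite eqSS (gtn_eqF k_gt0) !ltn_eqF ?ltnS // ?leqW //.
by rewrite subSnn.
Qed.

(* The derivative of phi_(k+1) used in the symbol {a b w c e}; P and Q are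
   replaced by second derivatives. *)
Definition symbol_op a b (w : seq V) c e k : R -> R :=
  if k == 0%N then mderiv a \o mderiv b
  else if k == m.+1 then mderiv c \o mderiv e
  else mderiv (nth ord0 w k.-1).

Definition const_mxs D k : 'M[K]_(betti m.+4 k, betti m.+4 k.+1) :=
  map_mx (const \o D k) (phi k).

(* The symbol {a b w c e}, multiplied by 2 if a = b and by 2 if c = e. *)
Definition polar_symbol a b (w : seq V) c e : K :=
  full_product (const_mxs (symbol_op a b w c e)).

Lemma eq_const_mxs D D' k : (forall f, D k f = D' k f) ->
  const_mxs D k = const_mxs D' k.
Proof. by move=> e; apply/matrixP=> i j; rewrite !mxE /= e. Qed.

Lemma polar_symbol_symL a b w c e : polar_symbol a b w c e = polar_symbol b a w c e.
Proof.
apply: eq_full_product => k _; apply: eq_const_mxs => f.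
by rewrite /symbol_op; case: eqP => //= _; rewrite mderiv_comm.
Qed.

Lemma polar_symbol_symR a b w c e : polar_symbol a b w c e = polar_symbol a b w e c.
Proof.
apply: eq_full_product => k _; apply: eq_const_mxs => f.
rewrite /symbol_op; case: eqP => //= _; case: eqP => //= _; exact: mderiv_comm.
Qed.

(** The second derivative of [phi k *m phi k.+1 = 0] at the origin: both factors vanish there, so
    only the mixed terms survive. *)
Lemma const_mulmx_deriv2 x y k :
  map_mx (const \o mderiv x) (phi k) *m map_mx (const \o mderiv y) (phi k.+1)
  + map_mx (const \o mderiv y) (phi k) *m map_mx (const \o mderiv x) (phi k.+1) = 0.
Proof.
apply/matrixP=> i j; rewrite !mxE -big_split /=.
transitivity (const ((phi k *m phi k.+1) i j)^`M(x)^`M(y)); last first.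
  by rewrite phi_mul0 mxE !mderiv0 mcoeff0.
rewrite mxE const_mderiv2_sum; apply: eq_bigr => l _.
by rewrite !mxE /= const_mderiv2M // const_phi mulr0 add0r.
Qed.

(** The third derivative of the same identity at the origin. As [phi k] has no linear terms, two
    derivatives must fall on it and one on [phi k.+1]. *)
Lemma const_mulmx_deriv3 x y z k : (forall i j t, const (phi k i j)^`M(t) = 0) ->
  map_mx (const \o (mderiv x \o mderiv y)) (phi k)
    *m map_mx (const \o mderiv z) (phi k.+1)
  + map_mx (const \o (mderiv y \o mderiv z)) (phi k)
    *m map_mx (const \o mderiv x) (phi k.+1)
  + map_mx (const \o (mderiv z \o mderiv x)) (phi k)
    *m map_mx (const \o mderiv y) (phi k.+1) = 0.
Proof.
move=> const_dphi; apply/matrixP=> i j; rewrite !mxE -!big_split /=.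
transitivity (const ((phi k *m phi k.+1) i j)^`M(z)^`M(y)^`M(x)); last first.
  by rewrite phi_mul0 mxE !mderiv0 mcoeff0.
rewrite mxE const_mderiv3_sum; apply: eq_bigr => l _.
rewrite !mxE /= mderivM !mderivD mcoeffD !const_mderiv2M ?const_phi ?const_dphi //.
by rewrite (mderiv_comm x z); ring.
Qed.

Lemma const_mulmx_deriv3r x y z k : (forall i j t, const (phi k.+1 i j)^`M(t) = 0) ->
  map_mx (const \o mderiv z) (phi k)
    *m map_mx (const \o (mderiv x \o mderiv y)) (phi k.+1)
  + map_mx (const \o mderiv x) (phi k)
    *m map_mx (const \o (mderiv y \o mderiv z)) (phi k.+1)
  + map_mx (const \o mderiv y) (phi k)
    *m map_mx (const \o (mderiv z \o mderiv x)) (phi k.+1) = 0.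
Proof.
move=> const_dphi; apply/matrixP=> i j; rewrite !mxE -!big_split /=.
transitivity (const ((phi k *m phi k.+1) i j)^`M(z)^`M(y)^`M(x)); last first.
  by rewrite phi_mul0 mxE !mderiv0 mcoeff0.
rewrite mxE const_mderiv3_sum; apply: eq_bigr => l _.
rewrite !mxE /= [phi k i l * _]mulrC mderivM !mderivD mcoeffD.
rewrite !const_mderiv2M ?const_phi ?const_dphi //.
by rewrite (mderiv_comm x z); ring.
Qed.

Lemma nth_cat_pair (s1 s2 : seq V) x y x' y' k :
  k != size s1 -> k != (size s1).+1 ->
  nth ord0 (s1 ++ x :: y :: s2) k = nth ord0 (s1 ++ x' :: y' :: s2) k.
Proof.
rewrite !nth_cat; case: ltnP => // le_k; rewrite -(subnKC le_k) addKn.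
by case: (k - _)%N => [|[|p]]; rewrite ?addn0 ?addn1 ?eqxx.
Qed.

Lemma polar_symbol_alt a b c e : alternating m (fun w => polar_symbol a b w c e).
Proof.
move=> s1 x y s2 sz; apply/eqP; rewrite -addr_eq0 addrC; apply/eqP.
have lt_m : ((size s1).+1 < m)%N.
  by rewrite -[X in (_ < X)%N]sz size_cat /= -2!addSnnS leq_addr.
have lt_p : ((size s1).+2 < m.+2)%N by rewrite !ltnS ltnW.
pose op (t : V * V) := symbol_op a b (s1 ++ t.1 :: t.2 :: s2) c e.
(* Entry [p] of the interior word belongs to the factor [p.+1], since factor 0 carries the pair
   [a, b]. *)
have := @full_product_cancel K m.+4 _ [:: (x, y); (y, x)] (const_mxs \o op)
  (const_mxs (op (x, y))) (size s1).+1 lt_p.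
rewrite !big_cons !big_nil !addr0; apply=> /=.
  move=> [x' y'] [|k] kp kp1 _; apply: eq_const_mxs => f; rewrite /op /symbol_op //=.
  by rewrite (@nth_cat_pair _ _ x' y' x y).
have opE x' y' : op (x', y') (size s1).+1 = mderiv x'.
  by rewrite /op /symbol_op /= eqSS ltn_eqF ?nth_cat ?ltnn ?subnn // ltnW.
have opE1 x' y' : op (x', y') (size s1).+2 = mderiv y'.
  by rewrite /op /symbol_op /= eqSS ltn_eqF // nth_cat ltnNge leqnSn subSnn.
by rewrite /const_mxs !opE !opE1 const_mulmx_deriv2.
Qed.

Lemma polar_symbol_cycL a b x w c e : size (x :: w) = m ->
  polar_symbol a b (x :: w) c e + polar_symbol b x (a :: w) c e
    + polar_symbol x a (b :: w) c e = 0.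
Proof.
move=> sz; have m_gt0 : (0 < m)%N by rewrite -[X in (_ < X)%N]sz.
pose op (t : V * V * V) := symbol_op t.1.1 t.1.2 (t.2 :: w) c e.
have := @full_product_cancel K m.+4 _ [:: (a, b, x); (b, x, a); (x, a, b)]
  (const_mxs \o op) (const_mxs (op (a, b, x))) 0%N isT.
rewrite !big_cons !big_nil !addr0 !addrA; apply=> /=.
  by move=> t [|[|k]] // _ _ _; apply: eq_const_mxs.
rewrite /const_mxs /op /symbol_op /= eqSS ltn_eqF //.
apply: const_mulmx_deriv3 => i j t; apply: homog_const_term (mderiv_homog _ _).
exact: phi_homog0.
Qed.

Lemma polar_symbol_cycR a b x w c e : size (x :: w) = m ->
  polar_symbol a b (x :: w) c e + polar_symbol a b (c :: w) e x
    + polar_symbol a b (e :: w) x c = 0.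
Proof.
move=> sz; have sz' y : size (y :: w ++ [::]) = m by rewrite cats0 -[RHS]sz.
(* The factor next to the right end carries the last interior entry, so the first entry is moved
   there, with the same sign in all three terms. *)
have move_last y c' e' : polar_symbol a b (y :: w) c' e'
    = (-1) ^+ size w * polar_symbol a b (rcons w y) c' e'.
  rewrite -[w in y :: w]cats0 (alternating_cons (polar_symbol_alt a b c' e')) //.
  by rewrite cats1.
rewrite !move_last -!mulrDr [X in _ * X](_ : _ = 0) ?mulr0 //.
have lt_p : (m.+1 < m.+2)%N by [].
pose op (t : V * V * V) := symbol_op a b (rcons w t.1.1) t.1.2 t.2.
have := @full_product_cancel K m.+4 _ [:: (x, c, e); (c, e, x); (e, x, c)]
  (const_mxs \o op) (const_mxs (op (x, c, e))) m lt_p.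
rewrite !big_cons !big_nil !addr0 !addrA; apply=> /=.
  move=> [[t1 t2] t3] k km km1 lt_k; apply: eq_const_mxs => f;
    rewrite /op /symbol_op /=.
  case: (k) km km1 => // k' km km1; rewrite (negPf km1) /= !nth_rcons.
  rewrite (_ : (k' == size w) = false) //; apply/negbTE.
  by rewrite -eqSS [X in _ == X](sz : (size w).+1 = m).
have opE t : op t m = mderiv t.1.1.
  have m_gt0 : (0 < m)%N by rewrite -[X in (_ < X)%N]sz.
  rewrite /op /symbol_op (gtn_eqF m_gt0) (ltn_eqF (ltnSn m)).
  by rewrite (_ : m.-1 = size w) ?nth_rcons ?ltnn ?eqxx // -[X in X.-1]sz.
have opE1 t : op t m.+1 = mderiv t.1.2 \o mderiv t.2.
  by rewrite /op /symbol_op eqxx.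
rewrite /const_mxs !opE !opE1 /=.
apply: const_mulmx_deriv3r => i j t; apply: homog_const_term (mderiv_homog _ _).
exact: phi_homog_last.
Qed.

(** By hypothesis, at the origin all derivatives in [op] fall on the entry of [A] or [B]; hence the
    polynomial identity descends to one between constant matrices. *)
Lemma const_adjoint (op : {additive R -> R}) p q r s (l : nat)
    (A : 'M[R]_(p, q)) (B : 'M[R]_(r, s)) (P : 'M[R]_(p, s)) (Q : 'M[R]_(q, r)) :
  (forall t u g, const (op (A t u * g)) = const (op (A t u)) * const g) ->
  (forall t u g, const (op (B t u * g)) = const (op (B t u)) * const g) ->
  A^T *m P = (-1) ^+ l *: (Q *m B) ->
  (map_mx (const \o op) A)^T *m map_mx const P
  = (-1) ^+ l *: (map_mx const Q *m map_mx (const \o op) B).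
Proof.
move=> opA opB AP; apply/matrixP=> u v; rewrite !mxE.
have sum_const o (F : 'I_o -> R) : const (op (\sum_t F t)) = \sum_t const (op (F t)).
  exact: (raddf_sum (const \o op)).
transitivity (const (op ((A^T *m P) u v))).
  by rewrite [in RHS]mxE sum_const; apply: eq_bigr => t _; rewrite !mxE opA.
rewrite AP [in LHS]mxE raddfMsign raddfMsign; congr (_ * _).
rewrite [in LHS]mxE; apply: etrans (sum_const _ _) _.
by apply: eq_bigr => t _; rewrite !mxE mulrC opB mulrC.
Qed.

Lemma const_mderiv_mul k t u x g :
  const (phi k t u * g)^`M(x) = const (phi k t u)^`M(x) * const g.
Proof. by rewrite const_mderivM. Qed.

Lemma const_mderiv2_mul k t u a b g : (forall x, const (phi k t u)^`M(x) = 0) ->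
  const (phi k t u * g)^`M(b)^`M(a) = const (phi k t u)^`M(b)^`M(a) * const g.
Proof. by move=> const_dphi; rewrite const_mderiv2M // !const_dphi !mul0r !addr0.
  Qed.

Lemma betti_vanish : betti m.+4 m.+3 = 0%N.
Proof.
by rewrite /betti /= eqSS gtn_eqF // bin_small // muln0.
Qed.

Lemma const_mxs_adjoint a b w c e i j (P : 'M[R]_(betti m.+4 i, betti m.+4 j.+1))
    (Q : 'M[R]_(betti m.+4 i.+1, betti m.+4 j)) (l : nat) :
  size w = m -> (i + j = m.+1)%N ->
  (phi i)^T *m P = (-1) ^+ l *: (Q *m phi j) ->
  (const_mxs (symbol_op c e w a b) i)^T *m map_mx const P
  = (-1) ^+ l *: (map_mx const Q *m const_mxs (symbol_op a b (rev w) c e) j).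
Proof.
move=> sz ij; rewrite /const_mxs /symbol_op.
have const_dphi0 t u x : const (phi 0%N t u)^`M(x) = 0.
  exact/homog_const_term/mderiv_homog/phi_homog0.
have const_dphi_last t u x : const (phi m.+1 t u)^`M(x) = 0.
  exact/homog_const_term/mderiv_homog/phi_homog_last.
case: i ij P Q => [|i] ij P Q.
  move: ij P Q; rewrite add0n => -> P Q; rewrite /= eqxx.
  by apply: (const_adjoint (op := mderiv c \o mderiv e)) => t u g;
    apply: const_mderiv2_mul => x.
case: j ij P Q => [|j] ij P Q.
  move: ij P Q; rewrite addn0 => -> P Q; rewrite /= eqxx.
  by apply: (const_adjoint (op := mderiv a \o mderiv b)) => t u g;
    apply: const_mderiv2_mul => x.
move: ij; rewrite addSn addnS => -[ij].
have lt_i : (i < m)%N by rewrite -[X in (_ < X)%N]ij ltnS leq_addr.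
have lt_j : (j < m)%N by rewrite -[X in (_ < X)%N]ij ltnS leq_addl.
rewrite /= !eqSS (ltn_eqF lt_i) (ltn_eqF lt_j).
have -> : nth ord0 (rev w) j = nth ord0 w i.
  have mj : (m - j.+1)%N = i by rewrite -[X in (X - _)%N]ij subSS addnK.
  by rewrite nth_rev sz // mj.
by apply: const_adjoint => t u g; apply: const_mderiv_mul.
Qed.

Lemma polar_symbol_rev a b w c e : size w = m ->
  polar_symbol c e w a b = - polar_symbol a b w c e.
Proof.
move=> sz.
have -> : polar_symbol c e w a b
    = (-1) ^+ (\sum_(i < m.+2) i)%N * polar_symbol a b (rev w) c e.
  pose P i j := pairing phi (betti_last m.+4) i j.
  apply: (@full_product_reverse _ _ _ _ (fun i j => map_mx const (P i j))) => [i j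
    ij|i j|i j] /=.
  - apply: const_mxs_adjoint => //; first by move: ij; rewrite addnS => -[].
    apply: pairing_phi => //; [exact: (mfr_exact phi_mfr)|exact: betti_vanish].
  - by rewrite mxE pairing_0N mpolyCK.
  - by rewrite mxE pairing_N0 mpolyCK.
rewrite -[rev w]cats0 (alternating_rev (polar_symbol_alt a b c e));
  last by rewrite cats0.
(* The exponents 0 + ... + (m + 1) from the pairing and 0 + ... + (m - 1) from reversing [w] have an
   odd sum. *)
rewrite cats0 sz mulrA -exprD !big_ord_recr /=.
rewrite -signr_odd !oddD /=.
by case: (odd (\sum_(i < m) i)%N); case: (odd m); rewrite /= expr1 mulN1r.
Qed.

(** * Second derivatives of the brackets *)

Definition op_mxs D k : 'M[R]_(betti m.+4 k, betti m.+4 k.+1) := map_mx (D k) (phi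
  k).

Definition deriv_factor D p x k : R -> R := if k == p then mderiv x \o D k else D k.

Lemma mderiv_full_product D x :
  (full_product (op_mxs D))^`M(x)
  = \sum_(p < m.+2) full_product (op_mxs (deriv_factor D p x)).
Proof.
have d1 : mderiv x (1 : R) = 0 by rewrite -mpolyC1 mderivC.
apply: etrans (full_product_deriv (f := mderiv x) (op_mxs D) (mderivM x) d1) _.
apply: eq_bigr => p _; apply: eq_full_product => k _; apply/matrixP=> i j.
by rewrite /op_mxs /deriv_factor /=; case: eqP => _; rewrite !mxE.
Qed.

(* Only the two quadratic factors of a bracket have non-constant derivatives. *)
Lemma mderiv_bracket D (w : seq V) x :
  (forall k, (0 < k <= m)%N -> D k = mderiv (nth ord0 w k.-1)) ->
  (full_product (op_mxs D))^`M(x)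
  = full_product (op_mxs (deriv_factor D 0 x))
    + full_product (op_mxs (deriv_factor D m.+1 x)).
Proof.
move=> DP; rewrite mderiv_full_product big_ord_recl big_ord_recr /=.
rewrite big1 ?add0r // => p _; apply: (@full_product0 _ _ _ p.+1) => /=.
  by rewrite ltnS ltnW // ltnS.
apply/matrixP=> i j; rewrite !mxE /deriv_factor eqxx DP /=; last exact: ltn_ord.
by apply/mderiv_homog0/mderiv_homog/phi_homog_mid; exact: ltn_ord.
Qed.

Lemma full_product_polar D a b (w : seq V) c e :
  (forall k f, (k < m.+2)%N -> D k f = symbol_op a b w c e k f) ->
  full_product (op_mxs D) = (polar_symbol a b w c e)%:MP.
Proof.
move=> DP; rewrite /polar_symbol (map_full_product (mpolyC m.+3 (R := K))).
apply: eq_full_product => k lt_k; apply/matrixP=> i j; rewrite !mxE /= DP //.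
apply: homog0_const; rewrite /symbol_op; case: (k) lt_k i j => [|k'] lt_k i j /=.
  exact/mderiv_homog/mderiv_homog/phi_homog0.
case: eqP => [->|/eqP nk] in i j *; first
  exact/mderiv_homog/mderiv_homog/phi_homog_last.
apply/mderiv_homog/phi_homog_mid => /=; rewrite -ltnS ltn_neqAle nk //.
Qed.

(** Both derivatives must fall on the quadratic end factors. Two on the same end would give a third
    derivative of a quadratic form, so each end receives one. *)
Lemma bracket_mderiv2 i j x w y : size w = m ->
  (@bracket K m.+4 phi (x :: rcons w y))^`M(j)^`M(i)
  = (polar_symbol x i w j y + polar_symbol x j w i y)%:MP.
Proof.
move=> sz; pose D k : R -> R := mderiv (nth ord0 (x :: rcons w y) k).
have nthE k : (0 < k <= m)%N -> nth ord0 (x :: rcons w y) k = nth ord0 w k.-1.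
  by case: k => // k /= lt_k; rewrite nth_rcons sz lt_k.
have Dmid k : (0 < k <= m)%N -> D k = mderiv (nth ord0 w k.-1).
  by move=> le_k; rewrite /D nthE.
have Dmid' p z k : (p == 0%N) || (p == m.+1) -> (0 < k <= m)%N ->
    deriv_factor D p z k = mderiv (nth ord0 w k.-1).
  move=> p_end /andP[k_gt0 le_k]; rewrite -Dmid ?k_gt0 // /deriv_factor.
  by case/orP: p_end => /eqP->; [rewrite gtn_eqF | rewrite ltn_eqF].
have -> : @bracket K m.+4 phi (x :: rcons w y) = full_product (op_mxs D).
  apply: eq_full_product => k lt_k; apply/matrixP=> a b; rewrite !mxE /D.
  by rewrite (set_nth_default ord0) //= size_rcons sz.
rewrite (mderiv_bracket j Dmid) mderivD.
rewrite (mderiv_bracket i (fun k => @Dmid' 0%N j k isT)).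
rewrite (mderiv_bracket i (fun k => @Dmid' m.+1 j k _)); last by rewrite eqxx orbT.
rewrite (@full_product0 _ _ (op_mxs (deriv_factor (deriv_factor D 0 j) 0 i)) 0) //;
  last first.
  apply/matrixP=> a b; rewrite !mxE.
  exact/mderiv_homog0/mderiv_homog/mderiv_homog/phi_homog0.
rewrite (@full_product0 _ _ (op_mxs (deriv_factor (deriv_factor D m.+1 j) m.+1 i))
  m.+1) //; last first.
  apply/matrixP=> a b; rewrite !mxE /deriv_factor eqxx /=.
  exact/mderiv_homog0/mderiv_homog/mderiv_homog/phi_homog_last.
rewrite add0r addr0 mpolyCD addrC; congr (_ + _);
  apply: full_product_polar => k f lt_k.
  rewrite /deriv_factor /symbol_op /D; case: k lt_k => [|k] lt_k /=.
    exact: mderiv_comm.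
  rewrite nth_rcons sz eqSS; case: eqP => [->|/eqP nk]; first by rewrite ltnn.
  by have -> : (k < m)%N by rewrite ltn_neqAle nk; exact: lt_k.
rewrite /deriv_factor /symbol_op /D; case: k lt_k => [|k] lt_k /=.
  exact: mderiv_comm.
rewrite nth_rcons sz eqSS; case: eqP => [->|/eqP nk]; first by rewrite ltnn.
by have -> : (k < m)%N by rewrite ltn_neqAle nk; exact: lt_k.
Qed.

Lemma polar_symbol_relations : @symbol_relations K m polar_symbol.
Proof.
split; [exact: polar_symbol_symL | exact: polar_symbol_symR |
  exact: polar_symbol_alt | exact: polar_symbol_cycL | exact: polar_symbol_cycR |
  exact: polar_symbol_rev].
Qed.

(** At each end the second derivative doubles the coefficient of a square and keeps that of a mixed
    monomial. *)
Lemma polar_symbolE a b (w : seq V) c e : size w = m ->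
  polar_symbol a b w c e
  = ((a == b).+1 * (c == e).+1)%:R * @symb K m.+4 phi (a :: b :: w ++ [:: c; e]).
Proof.
move=> sz.
pose z k : K := if k == 0%N then (a == b).+1%:R else if k == m.+1 then (c ==
  e).+1%:R else 1.
have hess_const u v f : const f^`M(v)^`M(u) = (u == v).+1%:R * f@_(U_(u) + U_(v))%MM.
  by rewrite !mcoeff_deriv add0m mnm0E mulr1n mnm1E mulr_natl.
transitivity ((\prod_(k < m.+2) z k) * @symb K m.+4 phi (a :: b :: w ++ [:: c; e])).
  apply: full_product_scale => k lt_k; apply/matrixP=> i j.
  rewrite /z /symbol_op; case: k lt_k i j => [|k] lt_k i j.
    by rewrite !mxE /= hess_const.
  rewrite -[(m.+4 - 3)%N]/m.+1 -[(m.+4 - 2)%N]/m.+2 -[(m.+4 - 1)%N]/m.+3 !mxE /=.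
  rewrite !nth_cat sz ltnn subnn eqSS; case: eqP => [->|/eqP nk] in i j *.
    by rewrite !mxE /= hess_const ltnNge leqnSn subSnn.
  rewrite !mxE /= mul1r (_ : (k < m)%N) ?ltn_neqAle ?nk //.
  by rewrite (set_nth_default ord0) // sz ltn_neqAle nk; exact: lt_k.
congr (_ * _); rewrite big_ord_recl big_ord_recr /= /z /= eqxx big1 => [|k _].
  by rewrite mul1r natrM.
by rewrite eqSS ltn_eqF.
Qed.

End Resolution.

(** * Structure constants of a resolution expressed by symbols *)

Section StructureConstantsOfResolution.

Variables (K : fieldType) (m : nat).
Local Notation R := {mpoly K[m.+3]}.
Variables (I : R -> Prop) (phi : forall k, 'M[R]_(betti m.+4 k, betti m.+4 k.+1)).
Hypothesis phi_mfr : @minimal_free_resolution K m.+4 I phi.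
Local Notation V := 'I_m.+3.
Local Notation polar_symbol := (polar_symbol phi).

Definition structure_constant (k i j : V) : K :=
  (2 * m.+4)%:R^-1 * ((-1) ^+ k.+1 *
    \sum_(1 <= l < m.+3) hess_seq polar_symbol i j
      (iter (2 * l) (rot 1) [seq a <- enum 'I_m.+3 | a \notin [:: k]])).

Lemma bracket_mderiv2_seq i j (s : seq V) : size s = m.+2 ->
  (@bracket K m.+4 phi s)^`M(j)^`M(i) = (hess_seq polar_symbol i j s)%:MP.
Proof.
case/seq_rcons=> x [w [y [-> sz]]].
by rewrite (bracket_mderiv2 phi_mfr i j x y sz) (hess_seq_rcons _ i j x y sz).
Qed.

Lemma size_delete (k : V) : size [seq a <- enum 'I_m.+3 | a \notin [:: k]] = m.+2.
Proof. by apply: (@addnI 1); exact: (@size_cat_rest m [:: k] isT). Qed.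

Lemma coef_cE (k i j : V) :
  @coef_c K m.+4 phi k i j = (structure_constant k i j)%:MP.
Proof.
rewrite /coef_c /Omega /dbracket -mul_mpolyC [in RHS]mpolyCM; congr (_ * _).
rewrite -[(-1) ^+ _]/((-1 : R) ^+ k.+1).
have -> : (-1 : R) ^+ k.+1 = ((-1) ^+ k.+1)%:MP by rewrite rmorphXn rmorphN1.
rewrite !mderiv_mulC [in RHS]mpolyCM; congr (_ * _).
rewrite (raddf_sum (mpolyC m.+3 (R := K))).
apply: etrans (raddf_sum (mderiv i \o mderiv j) _ _ _) _.
apply: eq_bigr => l _; apply: bracket_mderiv2_seq.
have := size_delete k; rewrite -/(omit _).
by elim: (2 * l)%N => //= p IH /IH; rewrite size_rot.
Qed.

Hypothesis charK0 : [pchar K] =i pred0.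

Lemma natr_neq0 p : (0 < p)%N -> p%:R != 0 :> K.
Proof. by rewrite (proj1 (pcharf0P K) charK0) lt0n. Qed.

(** The sign (-1)^(k+1) of [Omega] is minus the signature of [k] followed by the other indices in
    increasing order; [sum_rot_bracket_hess] then passes to an arbitrary arrangement [x, w, y]. *)
Lemma structure_constantP (k i j x : V) (w : seq V) y :
  uniq [:: k, x, y & w] -> size w = m ->
  (2 * m.+4)%:R * structure_constant k i j
  = - (signature K (k :: x :: rcons w y) * dbracket_hess polar_symbol i j x w y).
Proof.
move=> u sz; rewrite mulVKf ?natr_neq0 //.
rewrite -(sum_rot_bracket_hess (polar_symbol_relations phi_mfr) _ _ (s := [seq a <-
  enum 'I_m.+3 | a \notin [:: k]])) ?size_delete //.
  by rewrite signature_cons_delete exprS mulN1r mulNr.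
exact: (@uniq_cat_rest m [:: k] isT).
Qed.

Let lreg_natr p : (0 < p)%N -> GRing.lreg (p%:R : K).
Proof. by move=> p_gt0; apply: mulfI; exact: natr_neq0. Qed.

Local Notation sg := (signature K).
Local Notation symbol := (@symb K m.+4 phi).

Let factor_gt0 (a b c e : V) : (0 < (a == b).+1 * (c == e).+1)%N.
Proof. by []. Qed.

Lemma symb_symL (a b : V) (w : seq V) c e : size w = m ->
  symbol (a :: b :: w ++ [:: c; e]) = symbol (b :: a :: w ++ [:: c; e]).
Proof.
move=> sz; apply: (lreg_natr (factor_gt0 a b c e)).
rewrite -(polar_symbolE phi a b c e sz) polar_symbol_symL.
by rewrite (polar_symbolE phi b a c e sz) (eq_sym b).
Qed.

Lemma symb_symR (a b : V) (w : seq V) c e : size w = m ->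
  symbol (a :: b :: w ++ [:: c; e]) = symbol (a :: b :: w ++ [:: e; c]).
Proof.
move=> sz; apply: (lreg_natr (factor_gt0 a b c e)).
rewrite -(polar_symbolE phi a b c e sz) polar_symbol_symR.
by rewrite (polar_symbolE phi a b e c sz) (eq_sym e).
Qed.

Lemma symb_rev (a b : V) (w : seq V) c e : size w = m ->
  symbol (c :: e :: w ++ [:: a; b]) = - symbol (a :: b :: w ++ [:: c; e]).
Proof.
move=> sz; apply: (lreg_natr (factor_gt0 a b c e)).
rewrite mulrN -(polar_symbolE phi a b c e sz) -(polar_symbol_rev phi_mfr a b c e sz).
by rewrite (polar_symbolE phi c e a b sz) mulnC.
Qed.

(** With [b = a] two terms of the cyclic relation agree; the resulting 2 cancels the 2 that the pair
    [a, a] contributes to the polar symbol. *)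
Lemma symb_cycL_diag (a x : V) (w : seq V) c e : size (x :: w) = m -> x != a ->
  symbol (a :: a :: (x :: w) ++ [:: c; e])
  = - symbol (x :: a :: (a :: w) ++ [:: c; e]).
Proof.
move=> sz xa; have p_gt0 : (0 < 2 * (c == e).+1)%N by [].
apply: (lreg_natr p_gt0).
have := polar_symbol_cycL phi_mfr a a c e sz.
rewrite (polar_symbol_symL phi a x) (polar_symbolE phi a a c e sz).
rewrite (polar_symbolE phi x a (w := a :: w) c e sz) eqxx (negPf xa).
rewrite mulrN -addrA => /eqP; rewrite addr_eq0 => /eqP->.
by rewrite mul1n natrM -mulrA -mulrDl mulr_natl [in RHS]mulr2n mulrDl.
Qed.

Section Indices.

Variables (i j k : V) (w : seq V).
Hypotheses (ijk : uniq [:: i, j, k & w]) (sz : size w = m).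

Let ij : (i == j) = false.
Proof. by move: ijk; rewrite /= !inE !negb_or => /andP[/andP[/negPf]]. Qed.

Let ik : (i == k) = false.
Proof. by move: ijk; rewrite /= !inE !negb_or => /andP[/and3P[_ /negPf]]. Qed.

Let jk : (j == k) = false.
Proof. by move: ijk; rewrite /= !inE !negb_or => /and3P[_ /andP[/negPf]]. Qed.

Let reg := lreg_natr (isT : 0 < 2 * m.+4)%N.

Lemma structure_constant_symb_ijk :
  structure_constant k i j
  = - sg (k :: i :: rcons w j) * symbol (i :: i :: w ++ [:: j; j]).
Proof.
apply: (@lreg_natr 4) => //.
have := structure_constant_ijk (polar_symbol_relations phi_mfr) structure_constantP
  reg ijk sz.
by move=> ->; rewrite polar_symbolE // !eqxx mulrCA.
Qed.

Lemma structure_constant_symb_jii :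
  structure_constant j i i
  = - sg (j :: i :: rcons w k) * symbol (i :: i :: w ++ [:: k; i]).
Proof.
apply: (@lreg_natr 2) => //.
have := structure_constant_jii (polar_symbol_relations phi_mfr) structure_constantP
  reg ijk sz.
by move=> ->; rewrite polar_symbolE // eqxx eq_sym ik mulrCA.
Qed.

Lemma structure_constant_symb_ijj_ikk :
  structure_constant j i j - structure_constant k i k
  = - sg (j :: i :: rcons w k) * symbol (i :: i :: w ++ [:: j; k]).
Proof.
apply: (@lreg_natr 2) => //.
have := structure_constant_ijj_ikk (polar_symbol_relations phi_mfr)
  structure_constantP reg ijk sz.
by move=> ->; rewrite polar_symbolE // eqxx jk mulrCA.
Qed.

Lemma structure_constant_symb_iii :
  structure_constant i i i - structure_constant j i j - structure_constant k i k
  = - sg (i :: j :: rcons w k) * symbol (i :: j :: w ++ [:: k; i]).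
Proof.
have := structure_constant_iii (polar_symbol_relations phi_mfr) structure_constantP
  reg ijk sz.
by move=> ->; rewrite polar_symbolE // ij eq_sym ik mul1r.
Qed.

Lemma structure_constant_symb_ijk_rev :
  structure_constant k i j
  = sg (k :: i :: rcons w j) * symbol (j :: j :: w ++ [:: i; i]).
Proof.
by rewrite structure_constant_symb_ijk (symb_rev j j i i sz) mulrNN.
Qed.

Lemma structure_constant_symb_jii_symR :
  structure_constant j i i
  = - sg (j :: i :: rcons w k) * symbol (i :: i :: w ++ [:: i; k]).
Proof. by rewrite structure_constant_symb_jii (symb_symR i i k i sz). Qed.

Lemma structure_constant_symb_ijj_ikk_rev :
  structure_constant j i j - structure_constant k i k
  = sg (j :: i :: rcons w k) * symbol (j :: k :: w ++ [:: i; i]).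
Proof.
by rewrite structure_constant_symb_ijj_ikk (symb_rev j k i i sz) mulrNN.
Qed.

Lemma structure_constant_symb_iii_rev :
  structure_constant i i i - structure_constant j i j - structure_constant k i k
  = sg (i :: j :: rcons w k) * symbol (i :: k :: w ++ [:: i; j]).
Proof.
rewrite structure_constant_symb_iii (symb_rev k i i j sz) mulrNN.
by rewrite (symb_symL k i i j sz).
Qed.

End Indices.

(** For [n = 5] the left end pair has to be [l, i]; [symb_cycL_diag] trades [i, i] for it, and its
    sign cancels the other one. *)
Lemma structure_constant_symb_jii_cycL (i j k l : V) (w : seq V) :
  uniq [:: i, j, k, l & w] -> size (l :: w) = m ->
  structure_constant j i i
  = sg (j :: i :: rcons (l :: w) k) * symbol (l :: i :: (i :: w) ++ [:: i; k]).
Proof.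
move=> ijkl sz; rewrite (structure_constant_symb_jii_symR ijkl sz).
rewrite (symb_cycL_diag i k sz) ?mulrNN //.
by move: ijkl; rewrite /= !inE !negb_or => /andP[/and4P[_ _]]; rewrite eq_sym.
Qed.

End StructureConstantsOfResolution.

Theorem theorem3p1 (n : nat) (hn : (4 <= n)%N) :
  exists e1 e2 e3 e4 : 'I_n.-1 -> 'I_n.-1 -> 'I_n.-1 -> bool,
  forall (K : fieldType) (L : closedFieldType) (iota : {rmorphism K -> L})
         (X : 'I_n -> 'rV[L]_n.-1) (phi : differentials K n),
    [pchar K] =i pred0 ->
    is_algebraic_closure iota ->
    points_in_general_position iota X ->
    minimal_free_resolution (points_ideal iota X) phi ->
    let c := coef_c phi in
    [/\ forall i j k : 'I_n.-1, uniq [:: i; j; k] ->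
        [/\ c k i j =
              ((-1) ^+ e1 i j k
                * symb phi ([:: i; i] ++ omit [:: i; j; k] ++ [:: j; j]))%:MP,
            c j i i =
              ((-1) ^+ e2 i j k
                * symb phi ([:: i; i] ++ omit [:: i; j] ++ [:: i]))%:MP,
            c j i j - c k i k =
              ((-1) ^+ e3 i j k
                * symb phi ([:: i; i] ++ omit [:: i; j; k] ++ [:: j; k]))%:MP
          & c i i i - c j i j - c k i k =
              ((-1) ^+ e4 i j k
                * symb phi ([:: i; j] ++ omit [:: i; j; k] ++ [:: k; i]))%:MP],
        n = 4%N ->
        forall (i j k : 'I_n.-1) (s : {perm 'I_n.-1}),
        codom s = [:: i; j; k] ->
        [/\ c k i j = ((-1) ^+ s * symb phi [:: j; j; i; i])%:MP,
            c j i i = ((-1) ^+ s * symb phi [:: i; i; i; k])%:MP,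
            c j i j - c k i k = ((-1) ^+ s * symb phi [:: i; i; j; k])%:MP
          & c i i i - c j i j - c k i k =
              ((-1) ^+ s * symb phi [:: i; k; i; j])%:MP]
      & n = 5%N ->
        forall (i j k l : 'I_n.-1) (s : {perm 'I_n.-1}),
        codom s = [:: i; j; k; l] ->
        [/\ c k i j = ((-1) ^+ s * symb phi [:: i; i; l; j; j])%:MP,
            c j i i = ((-1) ^+ s * symb phi [:: l; i; i; i; k])%:MP,
            c j i j - c k i k = ((-1) ^+ s * symb phi [:: j; k; l; i; i])%:MP
          & c i i i - c j i j - c k i k =
              ((-1) ^+ s * symb phi [:: i; j; l; k; i])%:MP]].
Proof.
case: n hn => [|[|[|[|m]]]] // _.
pose rest (s : seq 'I_m.+3) := [seq a <- enum 'I_m.+3 | a \notin s].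
(* The negations account for the minus signs before the signatures in the formulas for the
   constants. *)
exists (fun i j k => ~~ seq_sign (k :: i :: rcons (rest [:: i; j; k]) j)).
exists (fun i j k => ~~ seq_sign (j :: i :: rest [:: i; j])).
exists (fun i j k => ~~ seq_sign (j :: i :: rcons (rest [:: i; j; k]) k)).
exists (fun i j k => ~~ seq_sign (i :: j :: rcons (rest [:: i; j; k]) k)).
move=> K L iota X phi charK0 _ _ phi_mfr c.
have cE k i j : c k i j = (structure_constant phi k i j)%:MP := coef_cE phi_mfr k i
  j.
have cE2 (k i j k' i' j' : 'I_m.+3) : c k i j - c k' i' j'
    = (structure_constant phi k i j - structure_constant phi k' i' j')%:MP.
  by rewrite !cE mpolyCB.
have cE3 (i j k : 'I_m.+3) : c i i i - c j i j - c k i k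
    = (structure_constant phi i i i - structure_constant phi j i j
       - structure_constant phi k i k)%:MP.
  by rewrite cE2 cE [RHS]mpolyCB.
split.
- move=> i j k ijk.
  have w_uniq : uniq [:: i, j, k & rest [:: i; j; k]] := uniq_cat_rest ijk.
  have sz : size (rest [:: i; j; k]) = m.
    by apply: (@addnI 3); exact: (size_cat_rest ijk).
  have signP x y z : perm_eq (x :: y :: rcons (rest [:: i; j;
    k]) z) [:: i, j, k & rest [:: i; j; k]] ->
      (-1) ^+ (~~ seq_sign (x :: y :: rcons (rest [:: i; j;
        k]) z)) = - signature K (x :: y :: rcons (rest [:: i; j; k]) z).
    move=> xyz; rewrite opp_seq_signE // ?(perm_uniq xyz) //.
    by rewrite (perm_size xyz) /= sz.
  split; [rewrite cE | rewrite cE | rewrite cE2 | rewrite cE3]; congr (_%:MP).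
  + rewrite (structure_constant_symb_ijk phi_mfr charK0 w_uniq sz) -signP //.
    by apply/seq.permP => p; rewrite /= -cats1 count_cat /=; ring.
  + have ij_uniq : uniq [:: i; j] by exact: (mask_uniq ijk [:: true; true]).
    (* The constant does not involve [k], so the last remaining index [x] serves as third index; it
       stands next to the final [i] in the symbol. *)
    have := uniq_cat_rest ij_uniq; have := size_cat_rest ij_uniq.
    rewrite -/(rest _) /omit -/(rest _); case/lastP: (rest _) => // w x.
    rewrite /= size_rcons => -[sz'] w'_uniq.
    have {}w'_uniq : uniq [:: i, j, x & w].
      by rewrite -(perm_uniq (_ : perm_eq (i :: j :: rcons w x) _)) // !perm_cons
        perm_rcons.
    rewrite (structure_constant_symb_jii phi_mfr charK0 w'_uniq sz') cat_rcons.
    have jix : perm_eq (j :: i :: rcons w x) [:: i, j, x & w].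
      by apply/seq.permP => p; rewrite /= -cats1 count_cat /=; ring.
    have jix_sz : size (j :: i :: rcons w x) = m.+3 by rewrite /= size_rcons sz'.
    have jix_uniq : uniq (j :: i :: rcons w x) by rewrite (perm_uniq jix).
    by rewrite (opp_seq_signE K jix_uniq jix_sz).
  + rewrite (structure_constant_symb_ijj_ikk phi_mfr charK0 w_uniq sz) -signP //.
    by apply/seq.permP => p; rewrite /= -cats1 count_cat /=; ring.
  + rewrite (structure_constant_symb_iii phi_mfr charK0 w_uniq sz) -signP //.
    by apply/seq.permP => p; rewrite /= -cats1 count_cat /=; ring.
(* The interior word is empty; relative to [i, j, k] the order [k, i, j] is even and [j, i, k] is
   odd. *)
- move=> [m0]; subst m => i j k s sE.
  have ijk : uniq [:: i; j; k] by rewrite -sE map_inj_uniq ?enum_uniq //;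
    exact: perm_inj.
  have sgE : (-1) ^+ s = signature K [:: i; j; k] by rewrite -sE signature_codom.
  have jik : - signature K [:: j; i; k] = signature K [:: i; j; k].
    by rewrite -(@signature_alt 3 K [::] j i [:: k] erefl).
  have kij : signature K [:: k; i; j] = signature K [:: i; j; k].
    rewrite (@signature_alt 3 K [::] i k [:: j] erefl).
    by rewrite -(@signature_alt 3 K [:: i] k j [::] erefl).
  split; [rewrite cE | rewrite cE | rewrite cE2 | rewrite cE3];
    rewrite sgE; congr (_%:MP).
  + rewrite -kij.
    exact: (structure_constant_symb_ijk_rev phi_mfr charK0 (w := [::]) ijk erefl).
  + rewrite -jik.
    exact: (structure_constant_symb_jii_symR phi_mfr charK0 (w := [::]) ijk erefl).
  + rewrite -jik.
    exact: (structure_constant_symb_ijj_ikk phi_mfr charK0 (w := [::]) ijk erefl).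
  + exact: (structure_constant_symb_iii_rev phi_mfr charK0 (w := [::]) ijk erefl).
(* The interior word has one entry; relative to [i, j, k, l] the order [j, i, l, k] is even, while
   [k, i, l, j] and [i, j, l, k] are odd. *)
- move=> [m1]; subst m => i j k l s sE.
  have ijkl : uniq [:: i; j; k; l] by rewrite -sE map_inj_uniq ?enum_uniq //;
    exact: perm_inj.
  have sgE : (-1) ^+ s = signature K [:: i; j; k; l] by rewrite -sE signature_codom.
  have swap01 (x y z t : 'I_4) : signature K [:: x; y; z; t] = - signature K [:: y;
    x; z; t].
    exact: (@signature_alt 4 K [::] y x [:: z; t] erefl).
  have swap12 (x y z t : 'I_4) : signature K [:: x; y; z; t] = - signature K [:: x;
    z; y; t].
    exact: (@signature_alt 4 K [:: x] z y [:: t] erefl).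
  have swap23 (x y z t : 'I_4) : signature K [:: x; y; z; t] = - signature K [:: x;
    y; t; z].
    exact: (@signature_alt 4 K [:: x; y] t z [::] erefl).
  have jilk : signature K [:: j; i; l; k] = signature K [:: i; j; k; l].
    by rewrite swap01 swap23 opprK.
  have kilj : - signature K [:: k; i; l; j] = signature K [:: i; j; k; l].
    by rewrite (swap01 k) (swap12 i) (swap23 i l) (swap12 i) !opprK.
  have ijlk : - signature K [:: i; j; l; k] = signature K [:: i; j; k; l].
    by rewrite (swap23 i j l) opprK.
  split; [rewrite cE | rewrite cE | rewrite cE2 | rewrite cE3];
    rewrite sgE; congr (_%:MP).
  + rewrite -kilj.
    exact: (structure_constant_symb_ijk phi_mfr charK0 (w := [:: l]) ijkl erefl).
  + rewrite -jilk.
    exact: (structure_constant_symb_jii_cycL phi_mfr charK0 (w := [::]) ijkl erefl).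
  + rewrite -jilk.
    exact: (structure_constant_symb_ijj_ikk_rev phi_mfr charK0 (w := [:: l]) ijkl
      erefl).
  + rewrite -ijlk.
    exact: (structure_constant_symb_iii phi_mfr charK0 (w := [:: l]) ijkl erefl).
Qed.
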